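(* (i) Let $1/K$ be a gauge function and write $h:=1/K$. Then for every bounded Borel set $E\subset\mathbb R^d$, $$c_h(E)\ge\tfrac12C_K(E).$$ (ii) Let $h$ and $1/K$ be two gauge functions. Assume that $h$ and $K$ are (locally on $(0,\infty)$) absolutely continuous and that $\int_0^{\hat d}K(t)\,dh(t)<\infty$ for some $\hat d>0$. Then there exists a constant $A>0$, depending only on $d,\hat d,h$ and $K$, such that whenever $E\subset\mathbb R^d$ is a compact set with $d(E)\le\hat d$, $$C_K(E)\ge A\,c_h(E).$$
   Context: A gauge function is a strictly increasing continuous $f:(0,\infty)\to[0,\infty)$ with $\lim_{t\to0^+}f(t)=0$. For a gauge function $f$, the $f$-Hausdorff content of $E\subset\mathbb R^d$ is $c_f(E)=\inf\{\sum_{j\ge1} f(d(B_j)):E\subset\bigcup_{j\ge1} B_j\}$, where the $B_j$ are open balls in $\mathbb R^d$ with diameter $d(B_j)$. For $K$ on $(0,\infty)$ with $1/K$ a gauge function (so $K(0)=+\infty$), the $K$-capacity of a bounded Borel set $E\subset\mathbb R^d$ is $$C_K(E)=\sup\Big\{\Big(\int\!\!\int K(|x-y|)\,d\mu(x)\,d\mu(y)\Big)^{-1}:\ \mu\text{ a Radon measure on }\mathbb R^d,\ \mathrm{supp}\,\mu\subset E,\ \mu(\mathbb R^d)=1\Big\},$$ with $1/\infty=0$ and $C_K(\emptyset)=0$. $d(E)=\sup\{|x-y|:x,y\in E\}$ is the diameter. *)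

(* Defs.v *)
From HB Require Import structures.
From mathcomp Require Import all_boot all_order all_algebra.
From mathcomp Require Import all_classical all_reals all_analysis.

Set Implicit Arguments.
Unset Strict Implicit.
Unset Printing Implicit Defensive.

Import Order.TTheory GRing.Theory Num.Theory.
Import numFieldNormedType.Exports.

Local Open Scope classical_set_scope.
Local Open Scope ring_scope.

(* Functions on (0, oo) are total functions R -> R whose values outside (0, oo)
   are never used. *)
Definition is_gauge (R : realType) (f : R -> R) : Prop :=
  [/\ forall t, 0 < t -> 0 <= f t,
      forall s t, 0 < s -> s < t -> f s < f t,
      forall t : R, 0 < t -> f x @[x --> t] --> f t
    & f x @[x --> 0^'+] --> 0].

(* R^d is 'rV[R]_d. The library norm of 'rV[R]_d is the sup norm: it gives the
   usual topology and bounded sets, but lengths have to be measured with the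
   Euclidean norm below. *)
Definition enorm (R : realType) (d : nat) (x : 'rV[R]_d) : R :=
  Num.sqrt (\sum_(i < d) x ord0 i ^+ 2).

Definition eball (R : realType) (d : nat) (x : 'rV[R]_d) (r : R) :
    set 'rV[R]_d :=
  [set y | enorm (x - y) < r].

(* A real supremum: meaningful for bounded E only, and 0 for E = set0. *)
Definition diam (R : realType) (d : nat) (E : set 'rV[R]_d) : R :=
  sup [set r | exists x y, [/\ E x, E y & r = enorm (x - y)]].

(* Radii are positive, so that f is only evaluated on (0, oo) when 0 < d.
   Finite covers give the same infimum when f is a gauge function: complete them
   with balls of small radii. *)
Definition hcontent (R : realType) (d : nat) (f : R -> R)
    (E : set 'rV[R]_d) : \bar R :=
  ereal_inf [set s : \bar R |
    exists (x : nat -> 'rV[R]_d) (r : nat -> R),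
      [/\ forall j, 0 < r j,
          E `<=` \bigcup_j eball (x j) (r j)
        & s = (\sum_(0 <= j <oo) (f (diam (eball (x j) (r j))))%:E)%E]].

Definition borel_space (R : realType) (d : nat) :=
  g_sigma_algebraType (@open 'rV[R]_d).

Definition borel (R : realType) (d : nat) (E : set 'rV[R]_d) : Prop :=
  measurable (E : set (borel_space R d)).

Definition is_radon (R : realType) (d : nat)
    (mu : {measure set (borel_space R d) -> \bar R}) : Prop :=
  (forall C : set 'rV[R]_d, compact C -> (mu C < +oo)%E) /\
  (forall A : set 'rV[R]_d, borel A ->
     mu A = ereal_sup [set mu C | C in
              [set C : set 'rV[R]_d | compact C /\ C `<=` A]]).

Definition msupport (R : realType) (d : nat)
    (mu : {measure set (borel_space R d) -> \bar R}) : set 'rV[R]_d :=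
  [set x | forall U : set 'rV[R]_d, open U -> U x -> (0 < mu U)%E].

Definition kernel_ext (R : realType) (K : R -> R) (t : R) : \bar R :=
  if 0 < t then (K t)%:E else +oo%E.

Definition energy (R : realType) (d : nat) (K : R -> R)
    (mu : {measure set (borel_space R d) -> \bar R}) : \bar R :=
  (\int[mu]_x \int[mu]_y
     kernel_ext K (enorm ((x : 'rV[R]_d) - (y : 'rV[R]_d))))%E.

(* The inverse is that of \bar R, with +oo^-1 = 0. *)
Definition capacity (R : realType) (d : nat) (K : R -> R)
    (E : set 'rV[R]_d) : \bar R :=
  if pselect (E = set0) then 0%E else
  ereal_sup [set c : \bar R |
    exists mu : {measure set (borel_space R d) -> \bar R},
      [/\ is_radon mu, msupport mu `<=` E, mu setT = 1%E
        & c = ((energy K mu)^-1)%E]].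

Definition absolutely_continuous_on (R : realType) (a b : R) (f : R -> R) :
    Prop :=
  forall e : R, 0 < e -> exists2 delta : R, 0 < delta &
    forall (n : nat) (u v : 'I_n -> R),
      (forall i, [/\ a <= u i, u i <= v i & v i <= b]) ->
      trivIset [set: 'I_n] (fun i => [set` `]u i, v i[]) ->
      \sum_(i < n) (v i - u i) < delta ->
      \sum_(i < n) `|f (v i) - f (u i)| < e.

Definition locally_absolutely_continuous (R : realType) (f : R -> R) : Prop :=
  forall a b : R, 0 < a -> a <= b -> absolutely_continuous_on a b f.

(* The measure dh of a gauge function h is the Lebesgue-Stieltjes measure of
   the extension of h by 0 to (-oo, 0]. *)
Definition gauge_ext (R : realType) (h : R -> R) (t : R) : R :=
  if 0 < t then h t else 0.

Section gauge_stieltjes.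
Variables (R : realType) (h : R -> R).
Hypothesis gh : is_gauge h.

Lemma gauge_ext_nondecreasing :
  {homo gauge_ext h : x y / x <= y}.
Proof.
case: gh => h0 hmono _ _ x y xy; rewrite /gauge_ext.
case: ifPn => [x0|_]; last by case: ifPn => // y0; exact: h0.
rewrite (lt_le_trans x0 xy).
by move: xy; rewrite le_eqVlt => /predU1P[->//|xy]; apply/ltW/hmono.
Qed.

Lemma gauge_ext_right_continuous :
  forall x, gauge_ext h y @[y --> x^'+] --> gauge_ext h x.
Proof.
case: gh => _ _ hcont hlim x; rewrite {2}/gauge_ext.
have [x0|x0] := ltP 0 x.
  apply: (@cvg_trans _ (h y @[y --> x^'+])); last first.
    by apply: cvg_within_filter; exact: hcont.
  apply: near_eq_cvg; near=> y; rewrite /gauge_ext ifT//.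
  by apply: lt_trans x0 _; near: y; exact: nbhs_right_gt.
move: x0; rewrite le_eqVlt => /predU1P[->|x0].
  apply: cvg_trans hlim; apply: near_eq_cvg; near=> y.
  by rewrite /gauge_ext ifT//; near: y; exact: nbhs_right_gt.
apply: (@cvg_trans _ ((0 : R) @[y --> x^'+])); last exact: cvg_cst.
apply: near_eq_cvg; near=> y; rewrite /gauge_ext ifF//.
by apply/negbTE; rewrite -leNgt; near: y; exact: nbhs_right_le.
Unshelve. all: by end_near. Qed.

Definition gauge_cumulative : cumulative R R :=
  HB.pack_for (cumulative R R) (gauge_ext h)
    (isCumulative.Build R _ R (gauge_ext h)
      gauge_ext_nondecreasing gauge_ext_right_continuous).

End gauge_stieltjes.

Definition gauge_measure (R : realType) (h : R -> R) (gh : is_gauge h) :=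
  lebesgue_stieltjes_measure (gauge_cumulative gh).

(* Main.v *)
Require Import Defs.
From mathcomp Require Import all_boot all_order all_algebra.
From mathcomp Require Import all_classical all_reals all_analysis.
From mathcomp Require Import measurable_realfun ring lra zify.

(* (i) Let balls B_j cover E and cut them down to disjoint D_j.  Since K is
   decreasing, the energy of a probability measure mu on E is at least
   sum_j K(d(B_j)) mu(D_j)^2, and by Cauchy-Schwarz this is at least
   1 / sum_j h(d(B_j)); so c_h(E) >= C_K(E), even without the factor 1/2.

   (ii) Frostman's lemma without weak limits.  Put E in a cube and halve it
   repeatedly, which gives a binary tree of boxes.  The Hausdorff content of
   E inter Q, divided by c_h(E), is subadditive over the two halves of Q, so a
   unit mass can be sent down the tree greedily without ever exceeding it.  The
   masses are the lengths of nested subintervals of [0, 1), and mapping a point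
   of [0, 1) to a point of E in all the boxes of its branch pushes Lebesgue
   measure to a probability measure nu on E with
   nu(B(x, r)) <= c h(r), c = O_d(1 / c_h(E)).  No doubling of h is needed: a ball
   of radius r meets O_d(1) boxes which are themselves contained in balls of
   diameter at most r.  Comparing the level sets {K(|x - .|) > k} with
   {K > k} then bounds every potential by 1 + c int K dh, and
   1 <= h(O_d(dhat)) / c_h(E). *)

Import Order.TTheory GRing.Theory Num.Theory.
Import numFieldNormedType.Exports.

Local Open Scope classical_set_scope.
Local Open Scope ring_scope.

(** * Comparison of integrals and discrete layer-cake sums *)

(** The integral of a nonnegative function is a supremum over the simple functions below it, hence
    monotone for arbitrary functions. Potentials can thus be compared without discussing their
    measurability. *)
Lemma le_integral_ge0 d (T : measurableType d) (R : realType)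
    (mu : {measure set T -> \bar R}) (D : set T) (f g : T -> \bar R) :
    (forall x, D x -> (0 <= f x)%E) -> (forall x, D x -> (f x <= g x)%E) ->
  (\int[mu]_(x in D) f x <= \int[mu]_(x in D) g x)%E.
Proof.
move=> f0 fg; rewrite !(integral_mkcond D).
have h0 x : (0 <= (f \_ D) x)%E by exact: erestrict_ge0.
have h1 x : ((f \_ D) x <= (g \_ D) x)%E by exact: lee_restrict.
rewrite !ge0_integralTE//; last by move=> x; exact: le_trans (h1 x).
apply: le_ereal_sup => _ [u uf <-]; exists u => // x.
exact: le_trans (uf x) (h1 x).
Qed.

(** A partial sum of [n] terms reaches [n] or already [a], so a finite total below [a] is
    impossible. Together with [nneseries_indic_lt_le] this is a discrete layer-cake formula. *)
Lemma le_nneseries_indic_lt (R : realType) (a : \bar R) :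
  (a <= \sum_(0 <= k <oo) ((k%:R%:E < a)%E : nat)%:R%:E)%E.
Proof.
set S := (X in (_ <= X)%E).
have S_ge n : (\sum_(0 <= k < n) ((k%:R%:E < a)%E : nat)%:R%:E <= S)%E.
  by apply: nneseries_lim_ge => k _; rewrite lee_fin.
have H n : ((n%:R%:E : \bar R) <= \sum_(0 <= k < n) ((k%:R%:E < a)%E : nat)%:R%:E)%E \/
    (a <= \sum_(0 <= k < n) ((k%:R%:E < a)%E : nat)%:R%:E)%E.
  elim: n => [|n IH]; first by left; rewrite big_geq.
  rewrite big_nat_recr//=; set s := (\sum_(0 <= k < n) _)%E in IH *.
  have [na|an] := ltP (n%:R%:E)%E a.
    case: IH => [IH|IH].
      by left; rewrite -natr1 EFinD leeD2r.
    by right; rewrite (le_trans IH)// leeDl.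
  by right; rewrite adde0; case: IH => // IH; exact: le_trans IH.
have [a_le_S|Sa] := leP a S => //.
have S0 : (0 <= S)%E by apply: nneseries_ge0 => k _ _; rewrite lee_fin.
have Sfin : S \is a fin_num by rewrite ge0_fin_numE// (lt_le_trans Sa)// leey.
have [HS|aS] := H (Num.truncn (fine S)).+1.
- have := truncnS_gt (fine S); rewrite -lte_fin fineK// => lt.
  by have := lt_le_trans lt (le_trans HS (S_ge _)); rewrite ltxx.
- by have := lt_le_trans Sa (le_trans aS (S_ge _)); rewrite ltxx.
Qed.

Lemma nneseries_indic_lt_le (R : realType) (a : \bar R) : (0 <= a)%E ->
  (\sum_(0 <= k <oo) ((k.+1%:R%:E < a)%E : nat)%:R%:E <= a)%E.
Proof.
move=> a0; apply: lime_le.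
  by apply: is_cvg_nneseries => k _ _; rewrite lee_fin.
apply: nearW => n.
(* The extra bound by [n] drives the induction: if the new term counts, the sum is at most [n.+1],
   which is below [a]. *)
suff [] : ((\sum_(0 <= k < n) ((k.+1%:R%:E < a)%E : nat)%:R%:E <= a)%E /\
    (\sum_(0 <= k < n) ((k.+1%:R%:E < a)%E : nat)%:R%:E <= n%:R%:E :> \bar R)%E) by [].
elim: n => [|n [IH1 IH2]]; first by rewrite big_geq.
rewrite big_nat_recr//=; set s := (\sum_(0 <= k < n) _)%E in IH1 IH2 *.
have [na|an] := ltP (n.+1%:R%:E)%E a.
  have Hn : (s + 1%:E <= n.+1%:R%:E)%E by rewrite -natr1 EFinD leeD2r.
  by split => //; exact: le_trans Hn (ltW na).
by rewrite adde0; split => //; rewrite (le_trans IH2)// lee_fin ler_nat.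
Qed.

(** * Euclidean norm and balls *)

Section euclidean_norm.
Variables (R : realType) (d : nat).
Implicit Types (x y z : 'rV[R]_d) (A : set 'rV[R]_d).

Lemma coord_le_enorm x i : `|x ord0 i| <= enorm x.
Proof.
rewrite -sqrtr_sqr ler_wsqrtr// (bigD1 i)//= lerDl.
by apply: sumr_ge0 => j _; exact: sqr_ge0.
Qed.

Lemma enorm_le_sum x : enorm x <= \sum_i `|x ord0 i|.
Proof.
have s0 : 0 <= \sum_i `|x ord0 i| by exact: sumr_ge0.
rewrite -[leRHS](ger0_norm s0) -sqrtr_sqr ler_wsqrtr//.
rewrite expr2 mulr_suml; apply: ler_sum => i _.
rewrite -real_normK ?num_real// expr2 ler_wpM2l//.
by rewrite (bigD1 i)//= lerDl sumr_ge0.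
Qed.

Lemma enorm_le_coord x (c : R) : (forall i, `|x ord0 i| <= c) ->
  enorm x <= d%:R * c.
Proof.
move=> xc; apply: le_trans (enorm_le_sum x) _.
rewrite -[X in X%:R]card_ord mulr_natl -sumr_const.
exact: ler_sum.
Qed.

Lemma enormN x : enorm (- x) = enorm x.
Proof. by congr Num.sqrt; apply: eq_bigr => i _; rewrite mxE sqrrN. Qed.

Lemma enorm_eq0 x : (enorm x == 0) = (x == 0).
Proof.
apply/idP/idP => [/eqP x0|/eqP ->].
  apply/eqP/rowP => i; rewrite mxE; apply/eqP.
  by rewrite -normr_le0 -x0; exact: coord_le_enorm.
rewrite /enorm big1 ?sqrtr0// => i _; by rewrite mxE expr0n.
Qed.

Lemma continuous_enorm : continuous (@enorm R d).
Proof.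
have cs : continuous (fun x : 'rV[R]_d => \sum_i x ord0 i ^+ 2).
  apply: continuous_big => [|i _ x]; first exact: add_continuous.
  apply: (@continuous_comp _ _ _ (fun x : 'rV[R]_d => x ord0 i)
    (fun c : R => c ^+ 2)); first exact: coord_continuous.
  exact: exprn_continuous.
move=> x; apply: (@continuous_comp _ _ _
  (fun x : 'rV[R]_d => \sum_i x ord0 i ^+ 2) (@Num.sqrt R)); first exact: cs.
exact: sqrt_continuous.
Qed.

Lemma continuous_enormB x : continuous (fun y : 'rV[R]_d => enorm (x - y)).
Proof.
move=> y; apply: (@continuous_comp _ _ _ (fun y : 'rV[R]_d => x - y) (@enorm R d)).
  by apply: continuousB => //; exact: cst_continuous.
exact: continuous_enorm.
Qed.

Lemma open_eball x (r : R) : open (eball x r).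
Proof.
have -> : eball x r = (fun y => enorm (x - y)) @^-1` [set` `]-oo, r[].
  by apply/seteqP; split => y /=; rewrite in_itv.
apply: open_comp => [y _|]; first exact: continuous_enormB.
exact: interval_open.
Qed.

Lemma eball_center x (r : R) : 0 < r -> eball x r x.
Proof.
rewrite /eball /= subrr => r0.
by have /eqP -> : enorm (0 : 'rV[R]_d) == 0 by rewrite enorm_eq0.
Qed.

Lemma diam_le A (c : R) : 0 <= c ->
  (forall x y, A x -> A y -> enorm (x - y) <= c) -> diam A <= c.
Proof.
move=> c0 Ac; rewrite /diam; set S := [set _ | _].
have [->|/set0P S0] := eqVneq S set0; first by rewrite sup0.
by apply: ge_sup => // _ [x [y [Ax Ay ->]]]; exact: Ac.
Qed.

Lemma le_diam A (c : R) x y :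
  (forall x y, A x -> A y -> enorm (x - y) <= c) -> A x -> A y ->
  enorm (x - y) <= diam A.
Proof.
move=> Ac Ax Ay; apply: ub_le_sup; last by exists x, y.
by exists c => _ [x' [y' [Ax' Ay' ->]]]; exact: Ac.
Qed.

(** Bounding each coordinate by [2 * r] and summing stands in for the Euclidean triangle inequality;
    the lost factor [d] only affects constants. *)
Lemma eball_enorm_le z (r : R) x y : eball z r x -> eball z r y ->
  enorm (x - y) <= d%:R * (2 * r).
Proof.
move=> zx zy; apply: enorm_le_coord => i.
have -> : (x - y) ord0 i = (z - y) ord0 i - (z - x) ord0 i by rewrite !mxE; lra.
apply: le_trans (ler_normB _ _) _; rewrite mulr2n mulrDl mul1r lerD//.
  exact: le_trans (coord_le_enorm _ _) (ltW zy).
exact: le_trans (coord_le_enorm _ _) (ltW zx).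
Qed.

Lemma diam_eball_le z (r : R) : 0 <= r -> diam (eball z r) <= d%:R * (2 * r).
Proof.
move=> r0; apply: diam_le; first by rewrite mulr_ge0// mulr_ge0.
by move=> x y; exact: eball_enorm_le.
Qed.

Lemma le_diam_eball z (r : R) x y : eball z r x -> eball z r y ->
  enorm (x - y) <= diam (eball z r).
Proof. by apply: le_diam => x' y'; exact: eball_enorm_le. Qed.

(** The centre and its translate by the vector with all entries r/(2d) are two distinct points of
    the ball: the translation has norm at most r/2. *)
Lemma diam_eball_gt0 z (r : R) : (0 < d)%N -> 0 < r -> 0 < diam (eball z r).
Proof.
move=> d0 r0; pose e : 'rV[R]_d := const_mx (r / (d%:R * 2)).
have dR : 0 < d%:R :> R by rewrite ltr0n.
have c0 : 0 < r / (d%:R * 2) by rewrite divr_gt0// mulr_gt0.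
have e_lt : enorm e < r.
  apply: (@le_lt_trans _ _ (d%:R * (r / (d%:R * 2)))).
    by apply: enorm_le_coord => i; rewrite mxE gtr0_norm.
  have -> : d%:R * (r / (d%:R * 2)) = r / 2 by field; rewrite gt_eqF.
  by lra.
have e_gt0 : 0 < enorm e.
  apply: lt_le_trans (coord_le_enorm e (Ordinal d0)).
  by rewrite mxE gtr0_norm.
apply: lt_le_trans e_gt0 _.
have -> : e = z + e - z by rewrite addrC addKr.
apply: le_diam_eball; last exact: eball_center.
by rewrite /eball /= opprD addNKr enormN.
Qed.

Lemma borel_open A : open A -> borel A.
Proof. exact: sub_sigma_algebra. Qed.

Lemma borel_closed A : closed A -> borel A.
Proof.
move=> cA; rewrite -[A]setCK; apply: (@measurableC _ (borel_space R d)).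
by apply: borel_open; exact: closed_openC.
Qed.

End euclidean_norm.

(** * Positivity and monotonicity of gauge functions *)

Section gauge.
Variables (R : realType) (f : R -> R).
Hypothesis gf : is_gauge f.

Lemma gauge_gt0 t : 0 < t -> 0 < f t.
Proof.
case: gf => f0 fmono _ _ t0; have t20 : 0 < t / 2 by rewrite divr_gt0.
by apply: le_lt_trans (f0 _ t20) _; apply: fmono => //; lra.
Qed.

Lemma gauge_le s t : 0 < s -> s <= t -> f s <= f t.
Proof.
case: gf => _ fmono _ _ s0; rewrite le_eqVlt => /predU1P[->//|st].
by apply/ltW/fmono.
Qed.

End gauge.

(** * The support of a Radon measure *)

Section radon.
Variables (R : realType) (d : nat).
Variable mu : {measure set (borel_space R d) -> \bar R}.

Lemma open_msupportC : open (~` msupport mu).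
Proof.
rewrite openE => x /= /existsNP[U] /not_implyP[oU] /not_implyP[Ux] /negP.
rewrite -leNgt => U0; apply: (filterS _ (open_nbhs_nbhs (conj oU Ux))).
by move=> y Uy /(_ U oU Uy); apply/negP; rewrite -leNgt.
Qed.

(** By inner regularity it suffices to treat compact subsets of the complement, and each of these is
    covered by finitely many open null sets. *)
Lemma radon_msupportC : is_radon mu -> mu (~` msupport mu) = 0%E.
Proof.
move=> [_ inner].
rewrite inner; last exact: borel_open open_msupportC.
apply/eqP; rewrite eq_le; apply/andP; split; last first.
  by apply: ereal_sup_ubound; exists set0; [split=> //; exact: compact0|].
apply: ge_ereal_sup => _ [C [cC CS] <-].
(* The cover is indexed by all sets, those that are not open null sets being replaced by the empty
   set. *)
have : finite_subset_cover [set: set 'rV[R]_d]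
    (fun U => if `[< open U /\ mu U = 0%E >] then U else set0) C.
  move: (cC); rewrite compact_cover; apply => [U _|x Cx].
    by case: asboolP => [[]//|_]; exact: open0.
  have /= := CS _ Cx.
  move=> /existsNP[U] /not_implyP[oU] /not_implyP[Ux] /negP.
  rewrite -leNgt measure_le0 => /eqP U0.
  exists U => //; case: asboolP => // nU; exfalso.
  exact: (nU (conj oU U0)).
case=> D _ CD.
have mD (U : set 'rV[R]_d) : measurable
    ((if `[< open U /\ mu U = 0%E >] then U else set0) : set (borel_space R d)).
  by case: asboolP => [[oU _]|_]; [exact: borel_open|exact: measurable0].
have cD : borel C by apply: borel_closed; exact: compact_closed.
apply: le_trans (content_sub_fsum mu (finite_fset D) (fun U _ => mD U) cD CD) _.
rewrite fsbig1// => U _; case: asboolP => [[]//|_]; exact: measure0.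
Qed.

End radon.

(** * Part (i) *)

Lemma two_mul_le_sqrD (R : realFieldType) (k m l : R) : 0 < k ->
  2 * l * m <= k * m ^+ 2 + l ^+ 2 * k^-1.
Proof.
move=> k0; rewrite -subr_ge0.
have -> : k * m ^+ 2 + l ^+ 2 * k^-1 - 2 * l * m = (k * m - l) ^+ 2 / k.
  by field; rewrite gt_eqF.
by rewrite divr_ge0 ?sqr_ge0// ltW.
Qed.

(** Disjointness leaves at most one nonzero term at [x]. *)
Lemma nneseries_indic_trivIset (R : realType) (T : Type) (D : nat -> set T)
    (c : nat -> R) (x : T) (b : \bar R) : (forall j, 0 <= c j) ->
  trivIset setT D -> (0 <= b)%E -> (forall j, D j x -> ((c j)%:E <= b)%E) ->
  (\sum_(0 <= j <oo) (c j * \1_(D j) x)%:E <= b)%E.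
Proof.
move=> c0 tD b0 cb.
have [[j Dj]|/forallNP nD] := pselect (exists j, D j x); last first.
  by rewrite eseries0// => j _ _; rewrite indicE memNset ?mulr0.
rewrite (@nneseriesD1 _ _ j)//=; last by move=> k _; rewrite lee_fin mulr_ge0.
rewrite eseries0 ?adde0.
  by rewrite indicE mem_set// mulr1; exact: cb.
move=> k _ kj; rewrite indicE memNset ?mulr0// => Dk.
by move/eqP: kj; apply; apply: (tD k j) => //; exists x.
Qed.

Section capacity_le.
Variables (R : realType) (d : nat) (K : R -> R).
Hypothesis d0 : (0 < d)%N.
Hypothesis gK : is_gauge (fun t => (K t)^-1).

Let K_gt0 t : 0 < t -> 0 < K t.
Proof. by move=> /(gauge_gt0 _ _ gK); rewrite invr_gt0. Qed.

Let K_le s t : 0 < s -> s <= t -> K t <= K s.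
Proof.
move=> s0 st; rewrite -lef_pV2 ?posrE ?K_gt0//; last exact: lt_le_trans st.
exact: (gauge_le _ _ gK).
Qed.

(** The value [+oo] at nonpositive arguments extends the monotonicity of [K] to the diagonal. *)
Lemma kernel_ext_ge s t : 0 < t -> s <= t -> ((K t)%:E <= kernel_ext K s)%E.
Proof.
move=> t0 st; rewrite /kernel_ext; case: ifPn => [s0|_]; last exact: leey.
by rewrite lee_fin K_le.
Qed.

Lemma kernel_ext_ge0 s : (0 <= kernel_ext K s)%E.
Proof. by rewrite /kernel_ext; case: ifPn => // s0; rewrite lee_fin ltW ?K_gt0. Qed.

(* Cauchy-Schwarz in linearised form: [K m^2 + l^2 / K >= 2 l m] summed over a
   disjointed cover with [l = 1 / s]. *)
Lemma inv_le_energy (mu : {measure set (borel_space R d) -> \bar R})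
    (x : nat -> 'rV[R]_d) (r : nat -> R) (s : R) :
  mu setT = 1%E -> (forall j, 0 < r j) -> 0 < s ->
  mu (~` \bigcup_j eball (x j) (r j)) = 0%E ->
  (\sum_(0 <= j <oo) ((K (diam (eball (x j) (r j))))^-1)%:E <= s%:E)%E ->
  ((s^-1)%:E <= energy K mu)%E.
Proof.
move=> mu1 r0 s0 cov sums.
pose B j : set (borel_space R d) := eball (x j) (r j).
have mB j : measurable (B j) by apply: borel_open; exact: open_eball.
pose D := seqDU B.
have mD j : measurable (D j) by exact: seqDU_measurable.
have tD : trivIset setT D by exact: trivIset_seqDU.
pose k j := K (diam (B j)).
have k0 j : 0 < k j by apply: K_gt0; exact: diam_eball_gt0.
have muD_fin j : mu (D j) \is a fin_num.
  rewrite ge0_fin_numE// (@le_lt_trans _ _ 1%E) ?ltry// -mu1.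
  by apply: le_measure; rewrite ?inE.
pose m j := fine (mu (D j)).
have m0 j : 0 <= m j by exact: fine_ge0.
have mE j : (m j)%:E = mu (D j) by rewrite fineK.
(* The cover carries all the mass, so the masses of its disjoint pieces add up to 1. *)
have summ : (\sum_(0 <= j <oo) (m j)%:E = 1)%E.
  under eq_eseriesr do rewrite mE.
  pose U : set (borel_space R d) := \bigcup_j D j.
  have mU : measurable U by exact: bigcup_measurable.
  have muUC : mu (~` U) = 0%E by rewrite /U /D -seqDU_bigcup_eq.
  rewrite -measure_semi_bigcup// -mu1 -(setUv U).
  rewrite measureU ?setICr//; last exact: measurableC.
  by transitivity (mu U + mu (~` U))%E; [rewrite muUC adde0|].
have km0 j : 0 <= k j * m j by rewrite mulr_ge0// ltW.
(* Two points of [D j] are at most the diameter of the [j]-th ball apart, so the piece containing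
   [y] alone contributes [k j * m j] to the potential at [y]. *)
have inner (y : borel_space R d) :
    (\sum_(0 <= j <oo) (k j * m j * \1_(D j) y)%:E <=
     \int[mu]_z kernel_ext K (enorm ((y : 'rV[R]_d) - (z : 'rV[R]_d))))%E.
  apply: nneseries_indic_trivIset => //.
    by apply: integral_ge0 => z _; exact: kernel_ext_ge0.
  move=> j Dy; rewrite EFinM mE.
  have -> : mu (D j) = (\int[mu]_z (\1_(D j) z)%:E)%E.
    by rewrite integral_indic// setIT.
  rewrite -ge0_integralZl//; last first.
  - by rewrite lee_fin ltW.
  - exact/measurable_EFinP/measurable_indic.
  apply: le_integral_ge0 => [z _|z _].
    by rewrite mule_ge0// lee_fin ltW.
  rewrite indicE; case: (boolP (z \in D j)) => [|_]; last first.
    by rewrite mule0 kernel_ext_ge0.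
  rewrite inE mule1 => Dz; apply: kernel_ext_ge; first exact: diam_eball_gt0.
  by apply: le_diam_eball; exact: (@subset_seqDU _ B j).
have : (\sum_(0 <= j <oo) (k j * m j ^+ 2)%:E <= energy K mu)%E.
  apply: (@le_trans _ _ (\int[mu]_y
      \sum_(0 <= j <oo) (k j * m j * \1_(D j) y)%:E)%E); last first.
    apply: le_integral_ge0 => // y _.
    by apply: nneseries_ge0 => j _ _; rewrite lee_fin mulr_ge0.
  rewrite integral_nneseries//; last 2 first.
    - move=> j; apply/measurable_EFinP; apply: measurable_funM.
        exact: measurable_cst.
      exact: measurable_indic.
    - by move=> j y _; rewrite lee_fin mulr_ge0.
  apply: lee_nneseries => [j _ _|j _].
    by rewrite lee_fin mulr_ge0 ?sqr_ge0// ltW.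
  under eq_integral do rewrite EFinM.
  rewrite ge0_integralZl ?lee_fin//; last first.
  - exact/measurable_EFinP/measurable_indic.
  by rewrite integral_indic// setIT -mE -EFinM -mulrA -expr2.
move=> Hen.
pose l := s^-1.
have l0 : 0 < l by rewrite invr_gt0.
(* As the masses sum to 1, summing the termwise inequality gives 2l <= energy + l^2 s, and l^2 s =
   l. *)
have : ((2 * l)%:E <= energy K mu + l%:E)%E.
  have -> : ((2 * l)%:E = \sum_(0 <= j <oo) (2 * l * m j)%:E)%E.
    under eq_eseriesr do rewrite EFinM.
    by rewrite nneseriesZl ?summ ?mule1// => j _; rewrite lee_fin.
  apply: (@le_trans _ _ (\sum_(0 <= j <oo) ((k j * m j ^+ 2)%:E +
      (l ^+ 2 * (k j)^-1)%:E))%E).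
    apply: lee_nneseries => [j _ _|j _].
      by rewrite lee_fin !mulr_ge0// ltW.
    by rewrite -EFinD lee_fin two_mul_le_sqrD.
  rewrite nneseriesD; last 2 first.
  - by move=> j _ _; rewrite lee_fin mulr_ge0 ?sqr_ge0// ltW.
  - by move=> j _ _; rewrite lee_fin mulr_ge0 ?sqr_ge0// invr_ge0 ltW.
  apply: leeD => //; under eq_eseriesr do rewrite EFinM.
  rewrite nneseriesZl; last by move=> j _; rewrite lee_fin invr_ge0 ltW.
  apply: le_trans (lee_wpmul2l _ sums) _; first by rewrite lee_fin sqr_ge0.
  by rewrite -EFinM lee_fin expr2 -mulrA mulVf ?mulr1// gt_eqF.
by rewrite -leeBlDr// -EFinB mulr2n mulrDl mul1r addrK.
Qed.

Lemma capacity_le_hcontent (E : set 'rV[R]_d) :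
  (capacity K E <= hcontent (fun t => (K t)^-1)%R E)%E.
Proof.
apply: le_ereal_inf_tmp => _ [x [r [r0 Exr ->]]].
have term_gt0 j : 0 < (K (diam (eball (x j) (r j))))^-1.
  by rewrite invr_gt0 K_gt0// diam_eball_gt0.
rewrite /capacity; case: pselect => [?|?].
  by apply: nneseries_ge0 => j _ _; rewrite lee_fin ltW.
apply: ge_ereal_sup => _ [mu [rmu smu mu1 ->]].
set S := (X in (_ <= X)%E).
have S_gt0 : (0 < S)%E.
  apply: (@lt_le_trans _ _ ((K (diam (eball (x 0%N) (r 0%N))))^-1)%:E).
    by rewrite lte_fin.
  rewrite /S (@nneseriesD1 _ _ 0%N)// => [|j _]; last by rewrite lee_fin ltW.
  by rewrite leeDl// nneseries_ge0// => j _ _; rewrite lee_fin ltW.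
have [S_oo|S_fin] := leP +oo%E S; first by apply: le_trans S_oo; exact: leey.
have [s Ss] : exists s, S = s%:E.
  by exists (fine S); rewrite fineK// ge0_fin_numE// ltW.
have s0 : 0 < s by rewrite -lte_fin -Ss.
have en : ((s^-1)%:E <= energy K mu)%E.
  apply: (@inv_le_energy _ x r) => //; last by rewrite -/S Ss.
  (* The balls cover [E], hence the support, so what they miss lies in a null set. *)
  apply/eqP; rewrite -measure_le0 -(radon_msupportC _ _ _ rmu).
  apply: le_measure; rewrite ?inE.
  - apply: measurableC; apply: bigcup_measurable => j _.
    by apply: borel_open; exact: open_eball.
  - by apply: borel_open; exact: open_msupportC.
  - by apply: subsetC; exact: subset_trans Exr.
have en0 : (0 <= energy K mu)%E.
  by apply: le_trans en; rewrite lee_fin invr_ge0 ltW.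
by rewrite Ss inve_ple ?inE ?lee_fin ?(ltW s0)// inver gt_eqF.
Qed.

End capacity_le.

(** * Hausdorff content *)

Section hausdorff_content.
Variables (R : realType) (d : nat) (h : R -> R).
Hypothesis d0 : (0 < d)%N.
Hypothesis gh : is_gauge h.
Implicit Types A B : set 'rV[R]_d.

Let dR : 0 < d%:R :> R. Proof. by rewrite ltr0n. Qed.

Lemma gauge_diam_eball_gt0 (x : 'rV[R]_d) r : 0 < r -> 0 < h (diam (eball x r)).
Proof. by move=> r0; apply: (gauge_gt0 _ _ gh); exact: diam_eball_gt0. Qed.

Lemma gauge_diam_eball_le (x : 'rV[R]_d) r : 0 < r ->
  h (diam (eball x r)) <= h (d%:R * (2 * r)).
Proof.
move=> r0; apply: (gauge_le _ _ gh); first exact: diam_eball_gt0.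
by apply: diam_eball_le; exact: ltW.
Qed.

Lemma gauge_small e : 0 < e -> exists2 t, 0 < t & h t < e.
Proof.
move=> e0; case: gh => _ _ _ /cvgr0Pnorm_lt /(_ e e0) He.
have : \forall t \near (0 : R)^'+, `|h t| < e /\ 0 < t.
  by near=> t; split; near: t; [exact: He|exact: nbhs_right_gt].
move=> /filter_ex H; have [t [ht t0]] := H (at_right_proper_filter 0).
by exists t => //; exact: le_lt_trans (ler_norm _) ht.
Unshelve. all: by end_near. Qed.

Lemma hcontent_ge0 A : (0 <= hcontent h A)%E.
Proof.
apply: le_ereal_inf_tmp => _ [x [r [r0 _ ->]]].
by apply: nneseries_ge0 => j _ _; rewrite lee_fin ltW// gauge_diam_eball_gt0.
Qed.

Lemma le_hcontent A B : A `<=` B -> (hcontent h A <= hcontent h B)%E.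
Proof.
move=> AB; apply: le_ereal_inf => _ [x [r [r0 cov ->]]].
by exists x, r; split => //; exact: subset_trans cov.
Qed.

(** Used to complete a finite cover to a sequence at cost [e]. The [j]-th radius is t/(2d) with h(t)
    < e / 2^(j+1), so that the ball has diameter at most t. *)
Lemma small_radii e : 0 < e -> exists r : nat -> R, (forall j, 0 < r j) /\
  forall x : nat -> 'rV[R]_d,
    (\sum_(0 <= j <oo) (h (diam (eball (x j) (r j))))%:E <= e%:E)%E.
Proof.
move=> e0.
have /choice[t Ht] : forall j : nat, exists t, 0 < t /\ h t < e / (2 ^ j.+1)%:R.
  move=> j; have [|t t0 ht] := @gauge_small (e / (2 ^ j.+1)%:R).
    by rewrite divr_gt0// ltr0n expn_gt0.
  by exists t.
exists (fun j => t j / (d%:R * 2)); split=> [j|x].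
  by rewrite divr_gt0 ?mulr_gt0//; case: (Ht j).
have r0 j : 0 < t j / (d%:R * 2) by rewrite divr_gt0 ?mulr_gt0//; case: (Ht j).
apply: le_trans (epsilon_trick0 xpredT (ltW e0)).
apply: lee_nneseries => [j _ _|j _].
  by rewrite lee_fin ltW// gauge_diam_eball_gt0.
rewrite lee_fin (le_trans (gauge_diam_eball_le _ _ (r0 j)))//.
have -> : d%:R * (2 * (t j / (d%:R * 2))) = t j by field; rewrite gt_eqF.
by case: (Ht j) => _ /ltW.
Qed.

Lemma hcontent_le_eball A (z : 'rV[R]_d) r : 0 < r -> A `<=` eball z r ->
  (hcontent h A <= (h (d%:R * (2 * r)))%:E)%E.
Proof.
move=> r0 Az; apply/lee_addgt0Pr => e e0.
have [rr [rr0 Hrr]] := small_radii e e0.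
apply: (@le_trans _ _ (\sum_(0 <= j <oo)
    (h (diam (eball z (if j is j'.+1 then rr j' else r))))%:E)%E).
  apply: ereal_inf_lbound; exists (fun=> z), (fun j => if j is j'.+1 then rr j' else r).
  split => //; first by case.
  by move=> y /Az zy; exists 0%N.
rewrite nneseries_recl//; last first.
  by case=> [|j] _; rewrite lee_fin ltW// gauge_diam_eball_gt0.
apply: leeD; first by rewrite lee_fin gauge_diam_eball_le.
rewrite -nneseries_addn; last first.
  by case=> [|j]; rewrite lee_fin ltW// gauge_diam_eball_gt0.
under eq_eseriesr do rewrite addn1.
exact: Hrr.
Qed.

Lemma hcontent_set0 : hcontent h (set0 : set 'rV[R]_d) = 0%E.
Proof.
apply/eqP; rewrite eq_le hcontent_ge0 andbT.
apply/lee_addgt0Pr => e e0; rewrite add0e.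
have [t t0 ht] := gauge_small e e0.
apply: le_trans (hcontent_le_eball set0 0 (t / (d%:R * 2)) _ _) _ => //.
  by rewrite divr_gt0// mulr_gt0.
have -> : d%:R * (2 * (t / (d%:R * 2))) = t by field; rewrite gt_eqF.
by rewrite lee_fin ltW.
Qed.

(** The first 2n interleaved terms are exactly the first n terms of each series. *)
Lemma interleave_nneseries (u v : nat -> \bar R) :
    (forall j, (0 <= u j)%E) -> (forall j, (0 <= v j)%E) ->
  (\sum_(0 <= j <oo) (if odd j then v j./2 else u j./2) <=
   \sum_(0 <= j <oo) u j + \sum_(0 <= j <oo) v j)%E.
Proof.
move=> u0 v0; apply: lime_le.
  by apply: is_cvg_nneseries => j _ _; case: ifP.
apply: nearW => n.
apply: (@le_trans _ _ (\sum_(0 <= j < n.*2) (if odd j then v j./2 else u j./2))%E).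
  apply: lee_sum_nneg_natr => [j _ _|]; first by case: ifP.
  by rewrite -addnn leq_addl.
apply: (@le_trans _ _ (\sum_(0 <= j < n) u j + \sum_(0 <= j < n) v j)%E).
  rewrite le_eqVlt; apply/orP; left; apply/eqP.
  elim: n => [|n IH]; first by rewrite !big_geq// adde0.
  rewrite doubleS !big_nat_recr//= IH odd_double /= uphalf_double doubleK.
  by rewrite -addeA addeACA.
by apply: leeD; apply: nneseries_lim_ge.
Qed.

(** Two covers, each optimal up to e/2, are interleaved into one sequence of balls. *)
Lemma hcontentU A B : (hcontent h (A `|` B) <= hcontent h A + hcontent h B)%E.
Proof.
have [Aoo|Afin] := leP +oo%E (hcontent h A).
  apply: (@le_trans _ _ +oo%E); first exact: leey.
  by apply: le_trans Aoo _; rewrite leeDl// hcontent_ge0.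
have [Boo|Bfin] := leP +oo%E (hcontent h B).
  apply: (@le_trans _ _ +oo%E); first exact: leey.
  by apply: le_trans Boo _; rewrite leeDr// hcontent_ge0.
apply/lee_addgt0Pr => e e0.
have e20 : 0 < e / 2 by rewrite divr_gt0.
have /(lb_ereal_inf_adherent e20) : hcontent h A \is a fin_num.
  by rewrite ge0_fin_numE// hcontent_ge0.
move=> [_ [x [r [r0 Ax ->]]] /ltW Hx].
have /(lb_ereal_inf_adherent e20) : hcontent h B \is a fin_num.
  by rewrite ge0_fin_numE// hcontent_ge0.
move=> [_ [y [s [s0 By ->]]] /ltW Hy].
have -> : (hcontent h A + hcontent h B + e%:E =
    (hcontent h A + (e / 2)%:E) + (hcontent h B + (e / 2)%:E))%E.
  by rewrite addeACA -EFinD -splitr.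
apply: le_trans (leeD Hx Hy).
apply: le_trans (interleave_nneseries _ _ _ _); last 2 first.
- by move=> j; rewrite lee_fin ltW// gauge_diam_eball_gt0.
- by move=> j; rewrite lee_fin ltW// gauge_diam_eball_gt0.
apply: ereal_inf_lbound.
exists (fun j => if odd j then y j./2 else x j./2),
  (fun j => if odd j then s j./2 else r j./2); split.
- by move=> j; case: ifP.
- move=> z [/Ax[j _ jz]|/By[j _ jz]].
    by exists j.*2 => //; rewrite odd_double doubleK.
  by exists j.*2.+1 => //=; rewrite odd_double /= uphalf_double.
- by apply: eq_eseriesr => j _; case: ifP.
Qed.

End hausdorff_content.

(** * Finite Borel measures are Radon *)

(** The remainders decrease to the empty set and have finite measure, so continuity from above
    applies. *)
Lemma nondecreasing_measure_approx disp (T : measurableType disp) (R : realType)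
    (mu : {measure set T -> \bar R}) (F : nat -> set T) (e : R) :
  (forall n, measurable (F n)) -> {homo F : m n / (m <= n)%N >-> m `<=` n} ->
  (mu (\bigcup_n F n) < +oo)%E -> 0 < e ->
  exists n, (mu ((\bigcup_n F n) `\` F n) <= e%:E)%E.
Proof.
move=> mF ndF muU e0; set U := \bigcup_n F n.
have mU : measurable U by exact: bigcup_measurable.
pose G n := U `\` F n.
have mG n : measurable (G n) by exact: measurableD.
have capG : \bigcap_n G n = set0.
  rewrite -subset0 => x Gx; have [[n _ Fnx] _] := Gx 0%N Logic.I.
  by have [_] := Gx n Logic.I.
have Gcvg : mu \o G @ \oo --> 0%E.
  rewrite -(measure0 mu) -capG; apply: nonincreasing_cvg_mu => //.
  - apply: le_lt_trans muU; apply: le_measure; rewrite ?inE//.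
    exact: subDsetl.
  - by rewrite capG; exact: measurable0.
  - by move=> m n mn; apply/subsetPset => x [Ux nF]; split => // /(ndF _ _ mn).
apply: contrapT => /forallNP nG.
have : (e%:E <= limn (mu \o G))%E.
  apply: lime_ge; first by apply/cvg_ex; exists 0%E.
  by apply: nearW => n; apply/ltW; rewrite ltNge; apply/negP; exact: nG.
by rewrite (cvg_lim _ Gcvg)// lee_fin leNgt e0.
Qed.

Section regularity.
Variables (R : realType) (d : nat).
Variable mu : {measure set (borel_space R d) -> \bar R}.
Hypothesis mu_fin : (mu setT < +oo)%E.
Implicit Types A F U : set (borel_space R d).

Let inner A := measurable A /\ forall e : R, 0 < e ->
  exists F, [/\ closed (F : set 'rV[R]_d), F `<=` A & (mu (A `\` F) <= e%:E)%E].

Let mu_lty A : measurable A -> (mu A < +oo)%E.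
Proof.
move=> mA; apply: le_lt_trans mu_fin; apply: le_measure; rewrite ?inE//.
Qed.

Let inner_closed A : closed (A : set 'rV[R]_d) -> inner A.
Proof.
move=> cA; split; first exact: borel_closed.
by move=> e e0; exists A; split => //; rewrite setDv measure0 lee_fin ltW.
Qed.

(** A countable union of closed sets need not be closed, so it is approximated by its finite partial
    unions. *)
Let inner_bigcup_approx (C : nat -> set (borel_space R d)) e :
  (forall n, closed (C n : set 'rV[R]_d)) -> 0 < e ->
  exists F, [/\ closed (F : set 'rV[R]_d), F `<=` \bigcup_n C n &
    (mu ((\bigcup_n C n) `\` F) <= e%:E)%E].
Proof.
move=> cC e0.
have mC n : measurable (C n) by apply: borel_closed; exact: cC.
pose F n : set (borel_space R d) := \big[setU/set0]_(i < n) C i.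
have UF : \bigcup_n F n = \bigcup_n C n.
  apply/seteqP; split => x [n _].
    rewrite /F -bigcup_mkord => -[i /= _ Cix]; by exists i.
  by move=> Cnx; exists n.+1 => //; rewrite /F -bigcup_mkord; exists n => /=.
have [||||n HF] := @nondecreasing_measure_approx _ _ _ mu F e.
- by move=> n; exact: bigsetU_measurable.
- by move=> m n mn; exact: subset_bigsetU.
- by apply: mu_lty; rewrite UF; exact: bigcup_measurable.
- exact: e0.
rewrite -UF; exists (F n); split => //.
- by apply: closed_bigsetU => i _; exact: cC.
- exact: bigcup_sup.
Qed.

Let inner_bigcup (A : nat -> set (borel_space R d)) :
  (forall n, inner (A n)) -> inner (\bigcup_n A n).
Proof.
move=> iA; have mA n : measurable (A n) by case: (iA n).
split; first exact: bigcup_measurable.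
move=> e e0; have e20 : 0 < e / 2 by rewrite divr_gt0.
have /choice[C HC] : forall n, exists F, [/\ closed (F : set 'rV[R]_d), F `<=` A n &
    (mu (A n `\` F) <= (e / 2 / (2 ^ n.+1)%:R)%:E)%E].
  by move=> n; case: (iA n) => _; apply; rewrite divr_gt0// ltr0n expn_gt0.
have cC n : closed (C n : set 'rV[R]_d) by case: (HC n).
have mC n : measurable (C n) by apply: borel_closed; exact: cC.
have CA n : C n `<=` A n by case: (HC n).
have [F [cF FC HF]] := inner_bigcup_approx C _ cC e20.
exists F; split => //.
  by apply: subset_trans FC _; exact: subset_bigcup.
have mF : measurable F by exact: borel_closed.
(* [W] lists all the errors: index 0 is the loss from truncating the union, costing e/2, and index
   [n.+1] the loss inside [A n], costing e/2 divided by 2^(n+1). *)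
pose W : nat -> set (borel_space R d) :=
  fun n => if n is n'.+1 then A n' `\` C n' else (\bigcup_n C n) `\` F.
have mW n : measurable (W n).
  case: n => [|n] /=; last exact: measurableD.
  by apply: measurableD => //; exact: bigcup_measurable.
apply: le_trans (measure_sigma_subadditive mu mW _ _) _.
- by apply: measurableD => //; exact: bigcup_measurable.
- move=> x [[n _ Anx] nFx].
  have [[m Cmx]|/forallNP nC] := pselect (exists m, C m x).
    by exists 0%N => //; split => //; exists m.
  by exists n.+1 => //; split => //; exact: nC.
rewrite nneseries_recl// (splitr e) EFinD; apply: leeD => //.
rewrite -nneseries_addn//; apply: le_trans (epsilon_trick0 xpredT (ltW e20)).
apply: lee_nneseries => // n _; rewrite addn1.
by case: (HC n).
Qed.

Let inner_bigcap (A : nat -> set (borel_space R d)) :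
  (forall n, inner (A n)) -> inner (\bigcap_n A n).
Proof.
move=> iA; have mA n : measurable (A n) by case: (iA n).
split; first exact: bigcap_measurable.
move=> e e0.
have /choice[C HC] : forall n, exists F, [/\ closed (F : set 'rV[R]_d), F `<=` A n &
    (mu (A n `\` F) <= (e / (2 ^ n.+1)%:R)%:E)%E].
  by move=> n; case: (iA n) => _; apply; rewrite divr_gt0// ltr0n expn_gt0.
have cC n : closed (C n : set 'rV[R]_d) by case: (HC n).
have mC n : measurable (C n) by apply: borel_closed; exact: cC.
have CA n : C n `<=` A n by case: (HC n).
exists (\bigcap_n C n); split => //.
- by apply: closed_bigI => n _; exact: cC.
- exact: subset_bigcap.
have mW n : measurable (A n `\` C n) by exact: measurableD.
apply: le_trans (measure_sigma_subadditive mu mW _ _) _.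
- by apply: measurableD => //; exact: bigcap_measurable.
- move=> x [Ax /existsNP[n /not_implyP[_ nC]]].
  by exists n => //; split => //; exact: Ax.
apply: le_trans (epsilon_trick0 xpredT (ltW e0)).
apply: lee_nneseries => // n _.
by case: (HC n).
Qed.

(** An open set is the union of the closed sets [F n] of points at sup-norm distance at least
    1/(n+1) from its complement. *)
Let inner_open U : open (U : set 'rV[R]_d) -> inner U.
Proof.
move=> oU.
pose F n : set 'rV[R]_d := ~` \bigcup_(y in ~` U) ball (y : 'rV[R]_d) n.+1%:R^-1.
have cF n : closed (F n).
  by apply: open_closedC; apply: bigcup_open => y _; exact: ball_open.
have UF : \bigcup_n F n = U.
  apply/seteqP; split => x.
    move=> [n _ nx]; apply: contrapT => Ux; apply: nx; exists x => //.
    by apply: ballxx; rewrite invr_gt0.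
  move=> Ux; have : nbhs (x : 'rV[R]_d) U by apply: open_nbhs_nbhs.
  move=> /nbhs_ballP[e /= e0 xeU].
  exists (Num.truncn e^-1) => // -[y nUy xy]; apply: nUy; apply: xeU.
  apply: le_ball (ball_sym xy).
  by rewrite -[leRHS]invrK lef_pV2 ?posrE ?invr_gt0// ltW// truncnS_gt.
rewrite -UF; apply: inner_bigcup => n; exact: inner_closed.
Qed.

(** The sets which, together with their complements, are approximable by closed subsets form a
    sigma-algebra containing the open sets. *)
Lemma borel_inner_closed A (e : R) : measurable A -> 0 < e ->
  exists F, [/\ closed (F : set 'rV[R]_d), F `<=` A & (mu (A `\` F) <= e%:E)%E].
Proof.
suff H : (@measurable _ (borel_space R d)) `<=` [set A | inner A /\ inner (~` A)].
  by move=> /H[[_ iA] _]; exact: iA.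
apply: smallest_sub.
- split => /=.
  + by rewrite setC0; split; apply: inner_closed; [exact: closed0|exact: closedT].
  + by move=> B [iB iBC]; rewrite setTD setCK.
  + move=> B iB; split; first by apply: inner_bigcup => n; case: (iB n).
    by rewrite setC_bigcup; apply: inner_bigcap => n; case: (iB n).
- move=> U oU /=; split; first exact: inner_open.
  by apply: inner_closed; exact: open_closedC.
Qed.

(** A closed approximation from inside is cut down to a large sup-norm ball, which makes it compact;
    each of the two losses is at most e/2. *)
Lemma finite_is_radon : is_radon mu.
Proof.
split=> [C cC|A' bA].
  by apply: mu_lty; apply: borel_closed; exact: compact_closed.
pose A : set (borel_space R d) := A'; rewrite -/A.
apply/eqP; rewrite eq_le; apply/andP; split; last first.
  apply: ge_ereal_sup => _ [C [cC CA] <-]; apply: le_measure; rewrite ?inE//.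
  by apply: borel_closed; exact: compact_closed.
apply/lee_addgt0Pr => e e0; have e20 : 0 < e / 2 by rewrite divr_gt0.
have [F [cF FA HF]] := borel_inner_closed _ _ bA e20.
have mF : measurable F by exact: borel_closed.
pose C n : set (borel_space R d) := F `&` [set x : 'rV[R]_d | `|x| <= n%:R].
have cC n : closed (C n : set 'rV[R]_d).
  apply: closedI => //.
  rewrite (_ : [set x : 'rV[R]_d | _] = Num.norm @^-1` [set t | t <= n%:R])//.
  apply: preimage_closed; last exact: closed_le.
  by move=> x _; exact: norm_continuous.
have mC n : measurable (C n) by exact: borel_closed.
have UC : \bigcup_n C n = F.
  apply/seteqP; split => [x [n _ []]//|x Fx].
  exists (Num.truncn `|x : 'rV[R]_d|).+1 => //; split => //=.
  by rewrite ltW// truncnS_gt.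
have [||||n] := @nondecreasing_measure_approx _ _ _ mu C (e / 2) => //.
- move=> m n mn x [Fx /= xm]; split => //=.
  by rewrite (le_trans xm)// ler_nat.
- by rewrite UC; exact: mu_lty.
rewrite UC => HC.
have kC : compact (C n : set 'rV[R]_d).
  apply: bounded_closed_compact => //.
  exists n%:R; split; first exact: num_real.
  by move=> x nx y [_ /= yn]; rewrite (le_trans yn)// ltW.
apply: (@le_trans _ _ (mu (C n) + e%:E)%E); last first.
  rewrite leeD2r//; apply: ereal_sup_ubound; exists (C n) => //.
  by split => //; apply: subset_trans FA; exact: subIsetl.
have AE : A = C n `|` ((A `\` F) `|` (F `\` C n)).
  apply/seteqP; split => x.
    move=> Ax; have [Cx|nCx] := pselect (C n x); first by left.
    right; have [Fx|nFx] := pselect (F x); first by right.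
    by left.
  by move=> [[/FA]|[[]|[/FA]]].
rewrite [in leLHS]AE.
have mAF : measurable (A `\` F) by exact: measurableD.
have mFC : measurable (F `\` C n) by exact: measurableD.
apply: le_trans (measureU2 _ _ _) _ => //; first exact: measurableU.
apply: leeD => //; apply: le_trans (measureU2 _ _ _) _ => //.
by rewrite (splitr e) EFinD; apply: leeD.
Qed.

End regularity.

(** * Mass distribution on a binary tree *)

Lemma exists_pushforward d1 d2 (T1 : measurableType d1) (T2 : measurableType d2)
    (R : realType) (mu : {measure set T1 -> \bar R}) (f : T1 -> T2) :
  measurable_fun setT f ->
  exists nu : {measure set T2 -> \bar R}, forall A, nu A = mu (f @^-1` A).
Proof. by move=> mf; unshelve eexists (pushforward mu f). Qed.

Lemma measure_bigsetU_le disp (T : measurableType disp) (R : realType)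
    (mu : {measure set T -> \bar R}) (I : finType) (P : pred I) (F : I -> set T) :
  (forall i, measurable (F i)) ->
  (mu (\big[setU/set0]_(i | P i) F i) <= \sum_(i | P i) mu (F i))%E.
Proof.
move=> mF.
suff [] : measurable (\big[setU/set0]_(i | P i) F i) /\
  (mu (\big[setU/set0]_(i | P i) F i) <= \sum_(i | P i) mu (F i))%E by [].
apply: (big_rec2 (fun x y => measurable x /\ (mu x <= y)%E)).
  by split => //; rewrite measure0.
move=> i y x _ [mx xy]; split; first exact: measurableU.
by apply: le_trans (measureU2 _ _ _) _ => //; exact: leeD2l.
Qed.

(* Words are read from the right: [b :: p] is the child [b] of the node [p]. *)
Section mass_distribution.
Variables (R : realType) (M : seq bool -> R).
Hypothesis M0 : forall p, 0 <= M p.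
Hypothesis M1 : M [::] = 1.
Hypothesis M_split : forall p, M p <= M (false :: p) + M (true :: p).

(* Greedy: the first child gets as much mass as its bound [M] allows. *)
Fixpoint mass (p : seq bool) : R :=
  if p is b :: q then
    let m := Num.min (mass q) (M (false :: q)) in
    if b then mass q - m else m
  else 1.

(** The [false] child takes the left end of its parent's interval and the [true] child the rest, so
    each level partitions [0, 1). *)
Fixpoint mass_start (p : seq bool) : R :=
  if p is b :: q then
    if b then mass_start q + mass (false :: q) else mass_start q
  else 0.

Definition mass_itv p : set R := `[mass_start p, mass_start p + mass p[%classic.

Fixpoint mass_path (t : R) (n : nat) : seq bool :=
  if n is n'.+1 then
    let p := mass_path t n' in (mass_start p + mass (false :: p) <= t) :: p
  else [::].

(** If the [false] child is filled up to its bound, then by [M_split] the rest of the parent's mass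
    is within the bound of the [true] child; otherwise nothing is left over. *)
Lemma mass_ge0_le p : 0 <= mass p <= M p.
Proof.
elim: p => [|b q /andP[q0 qM]] /=; first by rewrite M1 lexx ler01.
case: b; last by rewrite le_min q0 M0 ge_min lexx orbT.
rewrite subr_ge0 ge_min lexx /= lerBlDr.
case: (leP (mass q) (M (false :: q))) => _; first by rewrite lerDr M0.
by rewrite (le_trans qM)// addrC M_split.
Qed.

Lemma size_mass_path t n : size (mass_path t n) = n.
Proof. by elim: n => //= n ->. Qed.

Lemma mass_itv_sub b p : mass_itv (b :: p) `<=` mass_itv p.
Proof.
move=> t; rewrite /mass_itv /= !in_itv /=.
have /andP[m0 _] := mass_ge0_le (false :: p); rewrite /= in m0.
have ml : Num.min (mass p) (M (false :: p)) <= mass p by rewrite ge_min lexx.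
by case: b => /andP[h1 h2]; apply/andP; split; lra.
Qed.

Lemma mass_itv_path t n : t \in `[0, 1[ -> mass_itv (mass_path t n) t.
Proof.
move=> t01; elim: n => [|n]; first by rewrite /mass_itv /= add0r.
rewrite /mass_itv /= !in_itv /= => /andP[h1 h2].
set m := Num.min _ _.
by have [h|h] := leP (mass_start (mass_path t n) + m) t; apply/andP; split; lra.
Qed.

(** This expresses the disjointness of the intervals of one level: a point determines the word. *)
Lemma mass_pathP t p : mass_itv p t -> mass_path t (size p) = p.
Proof.
elim: p => //= b p IH pt; rewrite IH; last exact: mass_itv_sub pt.
congr cons; move: pt; rewrite /mass_itv /= !in_itv /=.
case: b => /andP[h1 h2] /=; first exact/idP.
by apply/negbTE; rewrite -ltNge.
Qed.

Lemma mass_itv_sub01 p : mass_itv p `<=` `[0, 1[%classic.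
Proof.
elim: p => [|b p IH]; first by rewrite /mass_itv /= add0r.
exact: subset_trans (mass_itv_sub b p) IH.
Qed.

Lemma lebesgue_mass_itv p : lebesgue_measure (mass_itv p) = (mass p)%:E.
Proof.
rewrite /mass_itv lebesgue_measure_itv /= lte_fin.
have /andP[m0 _] := mass_ge0_le p.
case: ltP => h; first by rewrite -EFinD addrAC subrr add0r.
by congr EFin; apply/eqP; rewrite eq_le m0 andTb; lra.
Qed.

Variables (d : nat) (E : set 'rV[R]_d) (Q : seq bool -> set 'rV[R]_d).
Hypothesis cE : compact E.
Hypothesis cQ : forall p, closed (Q p).
Hypothesis Q_child : forall b p, Q (b :: p) `<=` Q p.
Hypothesis Q_small : forall U x, open U -> U x ->
  exists n, forall p, size p = n -> Q p x -> Q p `<=` U.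
Hypothesis M_gt0 : forall p, 0 < M p -> E `&` Q p !=set0.

(** The half-open interval of each word on the path contains [t], so its mass is positive and its
    box meets [E]. Compactness of [E] then applies to the nested boxes. *)
Lemma mass_point t : t \in `[0, 1[ ->
  exists x, E x /\ forall n, Q (mass_path t n) x.
Proof.
move=> t01.
have ne n : E `&` Q (mass_path t n) !=set0.
  apply: M_gt0; have /andP[_] := mass_ge0_le (mass_path t n).
  apply: lt_le_trans; have := mass_itv_path _ n t01.
  by rewrite /mass_itv /= in_itv /= => /andP[h1 h2]; lra.
have mono m n : (m <= n)%N -> Q (mass_path t n) `<=` Q (mass_path t m).
  by move=> /subnK <-; elim: (n - m)%N => // k; apply: subset_trans; exact: Q_child.
apply: contrapT => /forallNP nx.
move: (cE); rewrite compact_cover => /(_ _ setT (fun n => ~` Q (mass_path t n))).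
case=> [n _|x Ex|D _ cov]; first exact: closed_openC.
  have /not_andP[//|/existsNP[n nQ]] := nx x.
  by exists n.
(* A point in the deepest box of the finite subcover lies in all the shallower ones, so it is not
   covered. *)
have [x [Ex Qx]] := ne (\max_(i <- finmap.enum_fset D) i)%N.
have [i /= Di] := cov x Ex; apply; apply: mono Qx.
exact: leq_bigmax_seq.
Qed.

(** The measure is the image of Lebesgue measure on [0, 1) under [X]. The preimage of [A] lies in
    the level-[n] intervals whose boxes meet [A], which gives the bound. *)
Lemma exists_mass_distribution :
  exists nu : {measure set (borel_space R d) -> \bar R},
    [/\ nu setT = 1%E, nu (~` E) = 0%E
      & forall n (A : set (borel_space R d)), measurable A ->
        (nu A <= \sum_(p : n.-tuple bool | `[< Q p `&` A !=set0 >]) (M p)%:E)%E].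
Proof.
have [x0 [Ex0 _]] : E `&` Q [::] !=set0 by apply: M_gt0; rewrite M1.
pose D : set (measurableTypeR R) := `[0, 1[%classic.
have mD : measurable D by exact: measurable_itv.
pose X (t : measurableTypeR R) : borel_space R d :=
  if t \in `[0, 1[ then
    xget x0 [set x | E x /\ forall n, Q (mass_path t n) x] else x0.
have XP t : D t -> E (X t) /\ forall n, Q (mass_path t n) (X t).
  rewrite /D /= /X => t01; rewrite t01.
  by have := mass_point t t01; exact: (@xgetPex _ x0).
have mI p : measurable (mass_itv p : set (measurableTypeR R)).
  exact: measurable_itv.
have mX : measurable_fun setT X.
  apply: (@measurability _ _ (measurableTypeR R) (borel_space R d) setT X
    (@open 'rV[R]_d)) => // _ [U oU <-].
  rewrite setTI.
  (* Measurability of [X]: since boxes shrink to points, [X t] lies in an open [U] exactly when some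
     box on the path of [t] is contained in [U]. The last term accounts for the constant value
     outside [0, 1). *)
  have -> : X @^-1` U = (\bigcup_n \big[setU/set0]_(p : n.-tuple bool | `[< Q p `<=` U >])
      mass_itv p) `|` (~` D `&` [set _ | U x0]).
    apply/seteqP; split => t /=.
      have [Dt Ut|nDt] := pselect (D t); last first.
        by rewrite /X ifN//; [right|exact/negP].
      left; have [EX QX] := XP t Dt; have [n Hn] := Q_small _ _ oU Ut.
      exists n => //; rewrite -bigcup_pred.
      have sz : size (mass_path t n) == n by rewrite size_mass_path.
      exists (Tuple sz); last exact: mass_itv_path.
      apply/asboolP; apply: Hn; [exact: size_mass_path|exact: QX].
    move=> [[n _]|[nDt]]; last by rewrite /X ifN//; exact/negP.
    rewrite -bigcup_pred => -[p /asboolP pU pt].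
    have Dt : D t by exact: mass_itv_sub01 pt.
    apply: pU; have [_ /(_ n)] := XP t Dt.
    by rewrite -[n in mass_path _ n](size_tuple p) mass_pathP.
  apply: measurableU.
    apply: bigcup_measurable => n _.
    by apply: bigsetU_measurable => p _; exact: mI.
  apply: measurableI; first exact: measurableC.
  have [Ux|Ux] := pselect (U x0).
    rewrite (_ : [set _ | _] = setT); last by apply/seteqP; split.
    exact: measurableT.
  rewrite (_ : [set _ | _] = set0); last by apply/seteqP; split.
  exact: measurable0.
have [nu nuE] := exists_pushforward _ _ _ _ _ (mrestr lebesgue_measure mD) _ mX.
exists nu; split.
- rewrite nuE preimage_setT /= /mrestr setTI /D lebesgue_measure_itv /=.
  by rewrite lte_fin ltr01 oppr0 adde0.
- rewrite nuE /= /mrestr (_ : _ `&` _ = set0) ?measure0//.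
  by rewrite -subset0 => t [nEX Dt]; apply: nEX; case: (XP t Dt).
- move=> n A mA; rewrite nuE /= /mrestr.
  apply: (@le_trans _ _ (lebesgue_measure (\big[setU/set0]_(p : n.-tuple bool |
      `[< Q p `&` A !=set0 >]) mass_itv p))).
    apply: le_measure; rewrite ?inE.
    + by apply: measurableI => //; rewrite -[X @^-1` A]setTI; exact: mX.
    + by apply: bigsetU_measurable => p _; exact: mI.
    + move=> t [At Dt]; rewrite -bigcup_pred.
      have sz : size (mass_path t n) == n by rewrite size_mass_path.
      exists (Tuple sz); last exact: mass_itv_path.
      apply/asboolP; exists (X t); split => //.
      by case: (XP t Dt) => _; exact.
  apply: le_trans (measure_bigsetU_le _ _ _ _ _ _ _ _) _.
    by move=> p; exact: mI.
  apply: lee_sum => p _; apply: (@le_trans _ _ (mass p)%:E).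
    by rewrite -lebesgue_mass_itv.
  rewrite lee_fin.
  by case/andP: (mass_ge0_le p).
Qed.

End mass_distribution.

(** * Boxes *)

(* The word [p] splits the cube [base + [0, s]^d] in half [size p] times, the
   [j]-th time along the coordinate [j %% d]; [cell i p] is the position of the
   resulting box on the [i]-th axis in units of [s / 2 ^ depth (size p) i]. *)
Section boxes.
Variables (R : realType) (d : nat) (base : 'rV[R]_d) (s : R).
Hypothesis d0 : (0 < d)%N.
Hypothesis s0 : 0 < s.

(** For [i < d], this counts the [j < n] with [j %% d = i]. *)
Definition depth (n i : nat) : nat := (n %/ d + (i < n %% d))%N.

Fixpoint cell (i : nat) (p : seq bool) : nat :=
  if p is b :: q then
    if i == (size q %% d)%N then (cell i q).*2 + b else cell i q
  else 0.

Definition box (p : seq bool) : set 'rV[R]_d :=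
  [set x | forall i : 'I_d,
    (cell i p)%:R <= (x ord0 i - base ord0 i) / s * 2 ^+ depth (size p) i
                  <= (cell i p).+1%:R].

Lemma depthS n i : (i < d)%N -> depth n.+1 i = (depth n i + (i == n %% d))%N.
Proof.
clear s0; move=> id; rewrite /depth; have := divn_eq n d; have := ltn_pmod n d0.
set q := (n %/ d)%N; set r := (n %% d)%N => rd nE.
have [rd1|] := ltnP r.+1 d.
  have -> : n.+1 = (q * d + r.+1)%N by rewrite nE addnS.
  by rewrite divnMDl// divn_small// modnMDl modn_small//; lia.
move=> dr; have -> : n.+1 = (q.+1 * d + 0)%N by rewrite nE mulSn; lia.
rewrite divnMDl// div0n modnMDl mod0n; lia.
Qed.

Lemma depth_mull N i : depth (N * d) i = N.
Proof. by rewrite /depth mulnK// modnMl ltn0 addn0. Qed.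

Lemma closed_box p : closed (box p).
Proof.
have -> : box p = \bigcap_(i in [set: 'I_d])
    ((fun x : 'rV[R]_d => (x ord0 i - base ord0 i) / s * 2 ^+ depth (size p) i)
      @^-1` `[(cell i p)%:R, (cell i p).+1%:R]%classic).
  apply/seteqP; split => x /= H i; first by move=> _ /=; rewrite in_itv/=; exact: H.
  by have := H i Logic.I; rewrite /= in_itv.
apply: closed_bigI => i _; apply: preimage_closed; last exact: itv_closed.
move=> x _; apply: (@continuous_comp _ _ _ (fun x : 'rV[R]_d => x ord0 i)
  (fun t : R => (t - base ord0 i) / s * 2 ^+ depth (size p) i)).
  exact: coord_continuous.
apply: cvgM; last exact: cvg_cst.
apply: cvgM; last exact: cvg_cst.
by apply: cvgB; [exact: cvg_id|exact: cvg_cst].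
Qed.

Lemma box_root (x : 'rV[R]_d) : (forall i, base ord0 i <= x ord0 i <= base ord0 i + s) ->
  box [::] x.
Proof.
move=> bx i /=; have /andP[h1 h2] := bx i.
rewrite /depth div0n mod0n ltn0 expr0 mulr1; apply/andP; split.
  by rewrite divr_ge0 ?subr_ge0// ltW.
by rewrite ler_pdivrMr// mul1r; lra.
Qed.

Let natr_double (c b : nat) : ((c.*2 + b)%:R = 2 * c%:R + b%:R :> R) *
  ((c.*2 + b).+1%:R = 2 * c%:R + b%:R + 1 :> R).
Proof.
have E : (c.*2 + b)%:R = 2 * c%:R + b%:R :> R.
  by rewrite natrD -muln2 natrM mulrC.
by split => //; rewrite -natr1 E.
Qed.

Lemma box_child b p : box (b :: p) `<=` box p.
Proof.
clear s0; move=> x bx i; have /= := bx i; rewrite depthS//.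
case: eqVneq => [iE|_]; last by rewrite addn0.
rewrite addn1 exprS mulrCA; set u := (_ * 2 ^+ _).
rewrite !natr_double -natr1.
by case: b bx => bx /= /andP[h1 h2]; apply/andP; split; lra.
Qed.

Lemma box_split p : box p `<=` box (false :: p) `|` box (true :: p).
Proof.
clear s0; move=> x bx.
pose j := Ordinal (ltn_pmod (size p) d0).
pose u i := (x ord0 i - base ord0 i) / s * 2 ^+ depth (size p) i.
(* Only the axis [j] being halved matters; in its units the cut is at the cell number plus 1/2. *)
have key b : (b = false -> u j <= (cell j p)%:R + 2^-1) ->
    (b = true -> (cell j p)%:R + 2^-1 <= u j) -> box (b :: p) x.
  move=> h1 h2 i /=; have := bx i; rewrite depthS// -/(u i).
  case: eqVneq => [iE|_]; last by rewrite addn0.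
  have -> : i = j by exact: val_inj.
  rewrite addn1 exprS mulrCA -/(u j).
  rewrite !natr_double -natr1.
  by case: b h1 h2 => h1 h2 /andP[h3 h4];
    [have := h2 erefl | have := h1 erefl] => h5 /=; apply/andP; split; lra.
have [le|lt] := leP (u j) ((cell j p)%:R + 2^-1).
  by left; apply: key.
by right; apply: key => // _; exact: ltW.
Qed.

Lemma box_coord_dist N p x y i : size p = (N * d)%N -> box p x -> box p y ->
  `|x ord0 i - y ord0 i| <= s / 2 ^+ N.
Proof.
move=> sp /(_ i) + /(_ i); rewrite sp depth_mull -natr1.
move=> /andP[x1 x2] /andP[y1 y2].
have pN : 0 < 2 ^+ N :> R by rewrite exprn_gt0.
have sN : 0 < s^-1 * 2 ^+ N by rewrite mulr_gt0// invr_gt0.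
have -> : s / 2 ^+ N = 1 / (s^-1 * 2 ^+ N) by rewrite div1r invfM invrK.
rewrite ler_pdivlMr// -[X in _ * X](gtr0_norm sN) -normrM.
by rewrite ler_norml; apply/andP; split; lra.
Qed.

Lemma box_small (U : set 'rV[R]_d) x : open U -> U x ->
  exists n, forall p, size p = n -> box p x -> box p `<=` U.
Proof.
move=> oU Ux; have /nbhs_ballP[e /= e0 xeU] : nbhs x U by exact: open_nbhs_nbhs.
have [N HN] : exists N, s / 2 ^+ N < e.
  exists (Num.truncn (s / e)).+1.
  rewrite ltr_pdivrMr ?exprn_gt0// mulrC -ltr_pdivrMr//.
  apply: lt_le_trans (truncnS_gt _) _.
  by rewrite -natrX ler_nat ltnW// ltn_expl.
exists (N * d)%N => p sp px y py; apply: xeU; split => // i j.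
rewrite (ord1 i) -ball_normE /=.
exact: le_lt_trans (box_coord_dist _ _ _ _ _ sp px py) HN.
Qed.

(** The head letter is the parity of the cell number on the axis split last, so words can be read
    off from positions. *)
Lemma cell_inj p q : size p = size q ->
  (forall i : 'I_d, cell i p = cell i q) -> p = q.
Proof.
elim: p q => [|b p IH] [|c q]//= [spq] H.
have {}H (i : 'I_d) : cell i p = cell i q /\ ((i : nat) = size q %% d -> b = c)%N.
  have := H i; rewrite spq; case: eqVneq => [_|/eqP ne h]; last by split=> // /ne.
  by case: b {H}; case: c; lia.
rewrite (IH q)//; last by move=> i; case: (H i).
by have [_ /= ->] := H (Ordinal (ltn_pmod (size q) d0)).
Qed.

(** On each axis the cell numbers of two boxes that meet [A] differ by less than [L], so they are
    determined by their residues modulo [L]. *)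
Lemma card_box_meet N (L : nat) (A : set 'rV[R]_d) :
  (forall x y i, A x -> A y -> `|x ord0 i - y ord0 i| / s * 2 ^+ N + 1 < L%:R) ->
  (#|[pred p : (N * d).-tuple bool | `[< box p `&` A !=set0 >]]| <= L ^ d)%N.
Proof.
move=> HA; set P := [pred p | _].
(* For [L = 0] the hypothesis applied to a single point of [A] is absurd, so [A] is empty. *)
case: L HA => [|L] HA.
  suff -> : #|P| = 0%N by [].
  apply: eq_card0 => p; rewrite !inE; apply/negP => /asboolP[x [_ Ax]].
  have := HA x x (Ordinal d0) Ax Ax; rewrite subrr normr0 !mul0r add0r.
  by rewrite ltr10.
pose f (p : (N * d).-tuple bool) : {ffun 'I_d -> 'I_L.+1} :=
  [ffun i : 'I_d => inord (cell i p %% L.+1)].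
have finj : {in P &, injective f}.
  move=> p q Pp Pq fpq.
  have [x [px Ax]] : box p `&` A !=set0 by exact/asboolP.
  have [y [qy Ay]] : box q `&` A !=set0 by exact/asboolP.
  suff : tval p = tval q by exact: val_inj.
  apply: cell_inj => [|i]; first by rewrite !size_tuple.
  have := congr1 (fun g : {ffun 'I_d -> 'I_L.+1} => val (g i)) fpq.
  rewrite /= !ffunE !inordK ?ltn_pmod// => pq.
  have := px i; have := qy i; rewrite !size_tuple depth_mull
    -(natr1 (cell i p)) -(natr1 (cell i q)).
  move=> /andP[y1 y2] /andP[x1 x2].
  have := HA x y i Ax Ay; have pN : 0 < 2 ^+ N :> R by rewrite exprn_gt0.
  have sN : 0 < s^-1 * 2 ^+ N by rewrite mulr_gt0// invr_gt0.
  rewrite -mulrA -[X in _ * X](gtr0_norm sN) -normrM -ltrBrDr ltr_norml.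
  move=> /andP[h1 h2].
  have k1 : (cell i p)%:R < L.+1%:R + (cell i q)%:R :> R by lra.
  have k2 : (cell i q)%:R < L.+1%:R + (cell i p)%:R :> R by lra.
  rewrite -natrD ltr_nat in k1; rewrite -natrD ltr_nat in k2.
  move: pq k1 k2; rewrite {-1}[L.+1]lock.
  move: (cell i p) (cell i q) => k k'; rewrite -lock => pq k1 k2.
  have := divn_eq k L.+1; have := divn_eq k' L.+1; rewrite pq.
  set r := (k' %% _)%N; set a := (k %/ _)%N; set b := (k' %/ _)%N => eb ea.
  have : a = b by nia.
  by move=> ab; rewrite ea eb ab.
rewrite -(card_in_image finj) (leq_trans (max_card _))//.
by rewrite card_ffun !card_ord.
Qed.

End boxes.

(** * Frostman's lemma *)

Lemma closed_enormB_le (R : realType) (d : nat) (x : 'rV[R]_d) (r : R) :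
  closed [set y : 'rV[R]_d | enorm (x - y) <= r].
Proof.
rewrite (_ : [set y | _] = (fun y => enorm (x - y)) @^-1` [set t | t <= r])//.
apply: preimage_closed; last exact: closed_le.
by move=> y _; exact: continuous_enormB.
Qed.

(** [N] is the least exponent for the first bound; it is positive because [r < C], and minimality
    gives the second bound. *)
Lemma exists_dyadic_scale (R : realType) (C r : R) : 0 < r -> r < C ->
  exists N, C / 2 ^+ N <= r /\ r * 2 ^+ N < 2 * C.
Proof.
move=> r0 rC.
have ex : exists N, C / r <= 2 ^+ N.
  exists (Num.truncn (C / r)).+1; rewrite (le_trans (ltW (truncnS_gt _)))//.
  by rewrite -natrX ler_nat ltnW// ltn_expl.
case: (ex_minnP ex) => -[|N]; first by rewrite expr0 ler_pdivrMr// mul1r leNgt rC.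
move=> HN Hmin; exists N.+1; split.
  by rewrite ler_pdivrMr ?exprn_gt0// mulrC -ler_pdivrMr.
rewrite exprS mulrCA ltr_pM2l// mulrC -ltr_pdivlMr// ltNge.
by apply/negP => /Hmin; rewrite ltnn.
Qed.

Section frostman.
Variables (R : realType) (d : nat) (h : R -> R) (E : set 'rV[R]_d) (D m : R).
Hypothesis d0 : (0 < d)%N.
Hypothesis gh : is_gauge h.
Hypothesis cE : compact E.
Hypothesis D0 : 0 < D.
Hypothesis ED : forall x y, E x -> E y -> enorm (x - y) <= D.
Hypothesis m0 : 0 < m.
Hypothesis hE : hcontent h E = m%:E.

Lemma frostman :
  exists nu : {measure set (borel_space R d) -> \bar R},
    [/\ nu setT = 1%E, nu (~` E) = 0%E
      & forall x r, 0 < r -> r <= D -> (nu [set y : 'rV[R]_d | (enorm (x - y) <= r)%R] <=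
          (((8 * d * d.+1).+1 ^ d)%:R * (h r / m))%:E)%E].
Proof.
have dR : 0 < d%:R :> R by rewrite ltr0n.
have [x0 Ex0] : E !=set0.
  apply/set0P/eqP => E0; move: hE; rewrite E0 hcontent_set0//.
  by move=> /eqP; rewrite eqe lt_eqF.
(* The root cube is centred at a point of [E] and has side 2D, so it contains [E]. *)
pose base : 'rV[R]_d := \row_i (x0 ord0 i - D).
pose s := 2 * D; have s0 : 0 < s by rewrite mulr_gt0.
pose Q := box _ _ base s.
pose M p := fine (hcontent h (E `&` Q p)) / m.
have Mfin p : hcontent h (E `&` Q p) \is a fin_num.
  rewrite ge0_fin_numE; last exact: hcontent_ge0.
  apply: le_lt_trans (ltry m); rewrite -hE.
  by apply: le_hcontent; exact: subIsetl.
have M0 p : 0 <= M p.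
  by apply: divr_ge0; [apply: fine_ge0; exact: hcontent_ge0|exact: ltW].
have M1 : M [::] = 1.
  rewrite /M (_ : E `&` Q [::] = E) ?hE /= ?divff ?gt_eqF//.
  apply/setIidl => x Ex; apply: box_root => // i; rewrite mxE.
  have := le_trans (coord_le_enorm _ _ (x - x0) i) (ED _ _ Ex Ex0).
  by rewrite !mxE ler_norml => /andP[h1 h2]; apply/andP; split; rewrite /s; lra.
have M_split p : M p <= M (false :: p) + M (true :: p).
  rewrite -mulrDl ler_pM2r ?invr_gt0// -lee_fin EFinD !fineK//.
  apply: le_trans (hcontentU _ _ _ d0 gh _ _); apply: le_hcontent.
  move=> x [Ex px]; have [qx|qx] := box_split _ _ base s d0 p x px.
    by left.
  by right.
have M_gt0 p : 0 < M p -> E `&` Q p !=set0.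
  move=> Mp; apply/set0P/eqP => EQ0; move: Mp.
  by rewrite /M EQ0 hcontent_set0//= mul0r ltxx.
have [nu [nu1 nuE nuA]] := exists_mass_distribution _ M M0 M1 M_split _ E Q cE
  (closed_box _ _ base s) (box_child _ _ base s d0)
  (box_small _ _ base s d0 s0) M_gt0.
exists nu; split => // x r r0 rD.
(* A box of side s/2^N lies in a ball of radius (d+1)s/2^N about each of its points, and C/2^N
   bounds the diameter of that ball. The factor d+1, instead of d, makes the inclusion in an open
   ball strict. *)
pose C := d%:R * (2 * (d.+1%:R * s)).
have d1 : 1 <= d%:R :> R by rewrite ler1n.
have DC : 8 * D <= C.
  have u2 : 0 <= d%:R * (d%:R + 1) - 2 :> R.
    by have := ler_pM (@ler01 R) (@ler01 R) d1 d1; lra.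
  by rewrite /C /s -natr1; have := mulr_ge0 u2 (ltW D0); lra.
have [N [HN1 HN2]] := exists_dyadic_scale _ C r r0 ltac:(lra).
have pN : 0 < 2 ^+ N :> R by rewrite exprn_gt0.
set A : set 'rV[R]_d := [set y | _].
have bA : borel A by apply: borel_closed; exact: closed_enormB_le.
apply: le_trans (nuA (N * d)%N A bA) _.
have Mle (p : (N * d).-tuple bool) : M p <= h r / m.
  rewrite ler_pM2r ?invr_gt0// -lee_fin fineK//.
  have [[z [Ez pz]]|/set0P/negP/negPn/eqP ->] := pselect (E `&` Q p !=set0); last first.
    by rewrite hcontent_set0// lee_fin ltW//; exact: gauge_gt0.
  pose rho := d.+1%:R * (s / 2 ^+ N).
  have rho0 : 0 < rho by rewrite mulr_gt0// divr_gt0.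
  apply: (@le_trans _ _ (h (d%:R * (2 * rho)))%:E).
    apply: hcontent_le_eball => // y [_ py].
    apply: (@le_lt_trans _ _ (d%:R * (s / 2 ^+ N))).
      apply: enorm_le_coord => i; rewrite !mxE.
      apply: (box_coord_dist _ _ base s d0 s0 N p) => //.
      by rewrite size_tuple.
    by rewrite /rho ltr_pM2r ?divr_gt0// ltr_nat.
  rewrite lee_fin; apply: (gauge_le _ _ gh).
    by rewrite !mulr_gt0// ?invr_gt0.
  apply: le_trans HN1; rewrite /C /rho; by rewrite !mulrA.
apply: (@le_trans _ _ (\sum_(p : (N * d).-tuple bool | `[< Q p `&` A !=set0 >])
    (h r / m)%:E)%E).
  by apply: lee_sum => p _; rewrite lee_fin.
rewrite sumEFin lee_fin sumr_const -[leLHS]mulr_natl.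
apply: ler_wpM2r; first by apply: divr_ge0; apply: ltW => //; exact: gauge_gt0.
rewrite ler_nat; apply: card_box_meet => // y z i Ay Az.
have yz : `|y ord0 i - z ord0 i| <= 2 * r.
  have := le_trans (coord_le_enorm _ _ (x - y) i) Ay.
  have := le_trans (coord_le_enorm _ _ (x - z) i) Az.
  by rewrite !mxE !ler_norml => /andP[? ?] /andP[? ?]; apply/andP; split; lra.
(* Coordinates in [A] differ by at most 2r, and r 2^N < 2C, so they span fewer than 4C/s = 8d(d+1)
   cells; the final successor is the [+ 1] of [card_box_meet]. *)
rewrite -(natr1 (8 * d * d.+1)) ltrD2r.
apply: (@le_lt_trans _ _ (2 * r / s * 2 ^+ N)).
  by rewrite ler_pM2r// ler_pM2r// invr_gt0.
rewrite mulrAC ltr_pdivrMr// -mulrA.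
have -> : (8 * d * d.+1)%:R * s = 2 * (2 * C) :> R.
  by rewrite /C !natrM; ring.
by rewrite ltr_pM2l.
Qed.

End frostman.

(** * Energy bound *)

Section energy_bound.
Variables (R : realType) (h K : R -> R) (D : R).
Hypothesis gh : is_gauge h.
Hypothesis gK : is_gauge (fun t => (K t)^-1).
Hypothesis D0 : 0 < D.

Let G : {measure set (measurableTypeR R) -> \bar R} :=
  lebesgue_stieltjes_measure (gauge_cumulative gh).

Lemma gauge_measure_itv s : 0 < s -> G `]0, s]%classic = (h s)%:E.
Proof.
move=> s0; transitivity (wlength (gauge_cumulative gh) `]0, s]%classic).
  exact: measurable_mu_extE (is_ocitv _ _).
by rewrite wlength_itv_bnd ?ltW//= /gauge_ext s0 ltxx subr0.
Qed.

Let S (k : nat) : set R := [set t | 0 < t <= D /\ k%:R < K t].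

Let K_le s t : 0 < s -> s <= t -> K t <= K s.
Proof.
move=> s0 st; have t0 := lt_le_trans s0 st.
have := gauge_gt0 _ _ gK _ s0; have := gauge_gt0 _ _ gK _ t0.
rewrite !invr_gt0 => Kt Ks.
by rewrite -lef_pV2 ?posrE//; exact: (gauge_le _ _ gK).
Qed.

Let S_down k s t : 0 < s -> s <= t -> S k t -> S k s.
Proof.
move=> s0 st [/andP[t0 tD] kt]; split; first by rewrite s0 (le_trans st).
by apply: lt_le_trans kt _; exact: K_le.
Qed.

Let measurable_S k : measurable (S k : set (measurableTypeR R)).
Proof.
apply: is_interval_measurable => x y Sx Sy z /andP[xz zy].
by apply: S_down zy Sy; case: Sx => /andP[x0 _] _; exact: lt_le_trans xz.
Qed.

Let S_nonempty k : S k !=set0.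
Proof.
have k0 : 0 < k.+1%:R^-1 :> R by rewrite invr_gt0.
have [t t0 Kt] := gauge_small _ _ gK _ k0.
have tD0 : 0 < Num.min t D by rewrite lt_min t0.
exists (Num.min t D); split; first by rewrite tD0 ge_min lexx orbT.
have tK : 0 < K t by rewrite -invr_gt0; exact: (gauge_gt0 _ _ gK).
apply: (@lt_le_trans _ _ (K t)); last by apply: K_le => //; rewrite ge_min lexx.
move: Kt; rewrite ltf_pV2 ?posrE// => Kt.
by apply: lt_trans Kt; rewrite ltr_nat.
Qed.

Let S_has_sup k : has_sup (S k).
Proof.
split; first exact: S_nonempty.
by exists D => t [/andP[]].
Qed.

Let rho k := sup (S k).

Let rho_gt0 k : 0 < rho k.
Proof.
have [t St] := S_nonempty k; case: (St) => /andP[t0 _] _.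
by apply: lt_le_trans t0 _; apply: ub_le_sup => //; case: (S_has_sup k).
Qed.

Let rho_le k : rho k <= D.
Proof. by apply: ge_sup => [|t [/andP[]]//]; exact: S_nonempty. Qed.

(** The set [S k] contains ]0, t] for each of its points t, and such t approach [rho k], where [h]
    is continuous. *)
Let h_rho_le k : ((h (rho k))%:E <= G (S k))%E.
Proof.
rewrite leNgt; apply/negP => lt.
have [g Gg] : exists g, G (S k) = g%:E.
  by exists (fine (G (S k))); rewrite fineK// ge0_fin_numE// (lt_trans lt)// ltry.
move: lt; rewrite Gg lte_fin => lt.
case: gh => _ _ hcont _.
have /cvgr_gt /(_ _ lt) /nbhs_ballP[e /= e0 He] := hcont _ (rho_gt0 k).
have [t St tlt] := sup_adherent e0 (S_has_sup k).
have [/andP[t0 tD] _] := St.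
have trho : t <= rho k by apply: ub_le_sup => //; case: (S_has_sup k).
have gt : g < h t.
  apply: He; rewrite /ball /= ger0_norm ?subr_ge0//.
  by rewrite ltrBlDr -ltrBlDl.
suff : h t <= g by rewrite leNgt gt.
rewrite -lee_fin -Gg -gauge_measure_itv//; apply: le_measure; rewrite ?inE//.
by move=> z /=; rewrite in_itv /= => /andP[z0 zt]; exact: S_down zt St.
Qed.

(** Summing the indicators of the [S k.+1] at t counts the positive integers below K(t), of which
    there are at most K(t). *)
Let sum_S_le : (\sum_(0 <= k <oo) G (S k.+1) <=
  \int[G]_(t in `]0%R, D]) (K t)%:E)%E.
Proof.
have -> : (\sum_(0 <= k <oo) G (S k.+1) = \int[G]_(t in `]0%R, D])
    \sum_(0 <= k <oo) (\1_(S k.+1) t)%:E)%E.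
  rewrite integral_nneseries//; last first.
    by move=> k; apply/measurable_EFinP/measurable_indic; exact: measurable_S.
  apply: eq_eseriesr => k _; rewrite integral_indic//.
  congr (G _); apply/esym/setIidl => t [tD _].
  by rewrite /= in_itv.
apply: le_integral_ge0 => [t _|t].
  by apply: nneseries_ge0 => k _ _; rewrite lee_fin.
rewrite /= in_itv /= => tD; have [t0 _] := andP tD.
have Kt0 : (0 <= (K t)%:E)%E.
  by rewrite lee_fin ltW// -invr_gt0; exact: (gauge_gt0 _ _ gK).
apply: le_trans (nneseries_indic_lt_le _ _ Kt0).
apply: lee_nneseries => [k _ _|k _]; first by rewrite lee_fin.
rewrite lee_fin lte_fin indicE; case: (boolP (t \in S k.+1)) => //.
by rewrite inE => -[_ ->].
Qed.

Variables (d : nat) (c : R) (nu : {measure set (borel_space R d) -> \bar R}).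
Hypothesis nu1 : nu setT = 1%E.
Hypothesis nu_ball : forall (x : 'rV[R]_d) r, 0 < r -> r <= D ->
  (nu [set y : 'rV[R]_d | (enorm (x - y) <= r)%R] <= (c * h r)%:E)%E.
Hypothesis nu_conc : exists x0 : 'rV[R]_d,
  nu [set y : 'rV[R]_d | (enorm (x0 - y) <= D)%R] = 1%E.
Hypothesis c0 : 0 <= c.

(* A measurable superset of [{y | k < kernel_ext K (enorm (x - y))}]. *)
Let B (x : 'rV[R]_d) (k : nat) : set (borel_space R d) :=
  if k%:R < K D then setT else [set y : 'rV[R]_d | enorm (x - y) <= rho k].

Let measurable_B x k : measurable (B x k).
Proof.
rewrite /B; case: ifP => _; first exact: measurableT.
by apply: borel_closed; exact: closed_enormB_le.
Qed.

(** For [k < K D] the level set [S k] is all of ]0, D], and the total mass 1 is controlled by the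
    one ball of radius [D] that carries [nu]. Otherwise the ball bound is used at radius [rho k]. *)
Let nu_B_le x k : (nu (B x k) <= c%:E * G (S k))%E.
Proof.
rewrite /B; case: ifP => [kD|_].
  have -> : S k = `]0, D]%classic.
    apply/seteqP; split => t; rewrite /= in_itv /=; first by case.
    by move=> tD; split => //; apply: lt_le_trans kD _; case/andP: tD; exact: K_le.
  rewrite gauge_measure_itv// -EFinM nu1.
  by have [x0 <-] := nu_conc; exact: nu_ball.
apply: le_trans (nu_ball _ _ (rho_gt0 k) (rho_le k)) _.
by rewrite EFinM; apply: lee_wpmul2l; [rewrite lee_fin|exact: h_rho_le].
Qed.

Let kernel_le x (y : borel_space R d) :
  (kernel_ext K (enorm (x - (y : 'rV[R]_d))) <=
   \sum_(0 <= k <oo) (\1_(B x k) y)%:E)%E.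
Proof.
apply: le_trans (le_nneseries_indic_lt _ _) _.
apply: lee_nneseries => [k _ _|k _]; first by rewrite lee_fin.
rewrite lee_fin indicE; case: ltP => //= kK.
suff : B x k y by move/mem_set ->.
rewrite /B; case: ifPn => //; rewrite -leNgt => KDk.
move: kK; rewrite /kernel_ext; case: ifPn => [xy0|].
  rewrite lte_fin => kK /=; apply: ub_le_sup; first by case: (S_has_sup k).
  split => //; rewrite xy0 /= leNgt; apply/negP => Dxy.
  have := K_le _ _ D0 (ltW Dxy); rewrite leNgt => /negP; apply.
  exact: le_lt_trans kK.
by rewrite -leNgt => xy0 _ /=; rewrite (le_trans xy0)// ltW.
Qed.

(** Every potential is at most the sum of the masses of the [B x k]: the term [k = 0] costs at most
    the total mass 1, and the others are compared with the [G (S k.+1)]. *)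
Lemma energy_le :
  (energy K nu <= 1 + c%:E * \int[G]_(t in `]0%R, D]) (K t)%:E)%E.
Proof.
set C := (X in (_ <= X)%E).
have inner (x : borel_space R d) :
    (\int[nu]_y kernel_ext K (enorm ((x : 'rV[R]_d) - (y : 'rV[R]_d))) <= C)%E.
  apply: (@le_trans _ _
      (\int[nu]_y \sum_(0 <= k <oo) (\1_(B x k) y)%:E)%E).
    apply: le_integral_ge0 => y _; last exact: kernel_le.
    exact: (kernel_ext_ge0 _ _ gK).
  rewrite integral_nneseries//; last first.
    by move=> k; apply/measurable_EFinP/measurable_indic; exact: measurable_B.
  under eq_eseriesr do rewrite integral_indic// setIT.
  rewrite nneseries_recl//; apply: leeD.
    by rewrite -nu1; apply: le_measure; rewrite ?inE.
  rewrite -nneseries_addn//; under eq_eseriesr do rewrite addn1.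
  apply: le_trans (lee_wpmul2l _ sum_S_le); last by rewrite lee_fin.
  rewrite -nneseriesZl//; apply: lee_nneseries => // k _; exact: nu_B_le.
rewrite /energy; apply: (@le_trans _ _ (\int[nu]_x C)%E).
  apply: le_integral_ge0 => x _; last exact: inner.
  by apply: integral_ge0 => y _; exact: (kernel_ext_ge0 _ _ gK).
by rewrite integral_cst// nu1 mule1.
Qed.

End energy_bound.

(** * From a measure carried by a compact set to the capacity bound *)

Lemma compact_enormB_le_diam (R : realType) (d : nat) (E : set 'rV[R]_d) x y :
  compact E -> E x -> E y -> enorm (x - y) <= diam E.
Proof.
move=> cE Ex Ey; have [M [_ HM]] := compact_bounded cE.
have {}HM z : E z -> forall i, `|z ord0 i| <= `|M| + 1.
  move=> Ez i; apply: le_trans (_ : `|z| <= _).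
    rewrite [leRHS]/Num.norm /= mx_normrE; apply/bigmax_geP; right => /=.
    by exists (ord0, i).
  by apply: HM => //; rewrite ltr_pwDr// ler_norm.
apply: (@le_diam _ _ E (d%:R * (2 * (`|M| + 1)))) => // z w Ez Ew.
apply: enorm_le_coord => i; rewrite !mxE (le_trans (ler_normB _ _))//.
by have := HM z Ez i; have := HM w Ew i; lra.
Qed.

(** A probability measure is Radon, and the complement of [E] is an open null set, so it contains no
    point of the support. *)
Lemma le_capacity (R : realType) (d : nat) (K : R -> R) (E : set 'rV[R]_d)
    (nu : {measure set (borel_space R d) -> \bar R}) :
  closed E -> nu setT = 1%E -> nu (~` E) = 0%E ->
  ((energy K nu)^-1 <= capacity K E)%E.
Proof.
move=> cE nu1 nuE; rewrite /capacity; case: pselect => [E0|nE0].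
  suff : nu (~` E) = 1%E by rewrite nuE => /eqP; rewrite eqe eq_sym oner_eq0.
  by rewrite {1}E0 setC0.
apply: ereal_sup_ubound; exists nu; split => //.
  by apply: finite_is_radon; rewrite nu1 ltry.
move=> x sx; apply: contrapT => nEx.
by have := sx _ (closed_openC cE) nEx; rewrite nuE ltxx.
Qed.

(** With m the content of [E], Frostman's measure has energy at most 1 + Lb/m = (m + Lb)/m. Bounding
    m by [H] makes the constant independent of [E]. *)
Lemma hcontent_le_capacity (R : realType) (d : nat) (h K : R -> R)
    (gh : is_gauge h) (dhat : R) : (0 < d)%N -> is_gauge (fun t => (K t)^-1) ->
  0 < dhat ->
  (\int[gauge_measure gh]_(t in `]0%R, dhat]) (K t)%:E < +oo)%E ->
  exists2 A : R, 0 < A &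
    forall E : set 'rV[R]_d, compact E -> diam E <= dhat ->
      (A%:E * hcontent h E <= capacity K E)%E.
Proof.
move=> d0 gK D0; set I := (X in (X < _)%E) => Ifin.
have I0 : (0 <= I)%E.
  apply: integral_ge0 => t; rewrite /= in_itv /= => /andP[t0 _].
  by rewrite lee_fin ltW// -invr_gt0; exact: (gauge_gt0 _ _ gK).
have [b Ib] : exists b, I = b%:E by exists (fine I); rewrite fineK// ge0_fin_numE.
have b0 : 0 <= b by rewrite -lee_fin -Ib.
pose L : R := ((8 * d * d.+1).+1 ^ d)%:R.
(* A nonempty [E] lies in the open ball of radius [2 * dhat] about any of its points, so its content
   is at most [H]. *)
pose H := h (d%:R * (2 * (2 * dhat))).
have H0 : 0 < H by apply: (gauge_gt0 _ _ gh); rewrite !mulr_gt0// ltr0n.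
have L0 : 0 <= L by [].
have HL0 : 0 < H + L * b by rewrite ltr_pwDl// mulr_ge0.
exists (H + L * b)^-1; first by rewrite invr_gt0.
move=> E cE ED.
have [->|/set0P[x0 Ex0]] := eqVneq E set0.
  by rewrite hcontent_set0// mule0 /capacity; case: pselect.
have clE : closed E by exact: compact_closed.
have {}ED x y : E x -> E y -> enorm (x - y) <= dhat.
  by move=> Ex Ey; apply: le_trans ED; exact: compact_enormB_le_diam.
have hEH : (hcontent h E <= H%:E)%E.
  apply: (hcontent_le_eball _ _ _ d0 gh E x0); first by rewrite mulr_gt0.
  by move=> y Ey; apply: le_lt_trans (ED _ _ Ex0 Ey) _; lra.
have hE0 := hcontent_ge0 _ _ _ d0 gh E.
have [m mE] : exists m, hcontent h E = m%:E.
  by exists (fine (hcontent h E)); rewrite fineK// ge0_fin_numE// (le_lt_trans hEH) ?ltry.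
rewrite mE lee_fin in hEH; rewrite mE lee_fin le_eqVlt in hE0.
(* If the content vanishes, the claim is that the capacity is nonnegative, which a Dirac mass at a
   point of [E] shows. *)
rewrite mE; case/predU1P: hE0 => [<-|m0].
  rewrite mule0.
  pose nu : {measure set (borel_space R d) -> \bar R} := \d_(x0 : borel_space R d).
  have nu1 : nu setT = 1%E by rewrite /nu /= diracT.
  have nuE : nu (~` E) = 0%E.
    by rewrite /nu /= diracE memNset//; exact.
  apply: le_trans (le_capacity _ _ K E nu clE nu1 nuE).
  rewrite inve_ge0; apply: integral_ge0 => x _; apply: integral_ge0 => y _.
  exact: (kernel_ext_ge0 _ _ gK).
have [nu [nu1 nuE nu_ball]] := frostman _ _ _ _ _ _ d0 gh cE D0 ED m0 mE.
apply: le_trans (le_capacity _ _ K E nu clE nu1 nuE).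
have en : (energy K nu <= 1 + (L / m)%:E * I)%E.
  apply: (energy_le R h K dhat gh gK D0 d (L / m) nu nu1).
  - move=> x r r0 rD; apply: le_trans (nu_ball x r r0 rD) _.
    by rewrite lee_fin mulrAC mulrA.
  - exists x0; set A := [set y | _].
    have mA : measurable (A : set (borel_space R d)).
      by apply: borel_closed; exact: closed_enormB_le.
    have mEC : measurable (~` E : set (borel_space R d)).
      by apply: borel_open; exact: closed_openC.
    apply/eqP; rewrite eq_le; apply/andP; split.
      by rewrite -nu1; apply: le_measure; rewrite ?inE.
    rewrite -[leRHS]adde0 -nuE -nu1.
    apply: le_trans (measureU2 nu mA mEC); apply: le_measure; rewrite ?inE//.
      exact: measurableU.
    move=> y _; have [Ey|nEy] := pselect (E y); last by right.
    by left; exact: ED.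
  - by rewrite divr_ge0// ltW.
have en0 : (0 <= energy K nu)%E.
  apply: integral_ge0 => x _; apply: integral_ge0 => y _.
  exact: (kernel_ext_ge0 _ _ gK).
rewrite -EFinM inve_pge ?inE// ?lee_fin; last first.
  by rewrite mulr_ge0// ?invr_ge0 ltW.
apply: le_trans en _; rewrite Ib -EFinM -EFinD inver gt_eqF ?mulr_gt0 ?invr_gt0//.
rewrite lee_fin invfM invrK.
have -> : 1 + L / m * b = (m + L * b) / m by field; rewrite gt_eqF.
by rewrite ler_pM2r ?invr_gt0// lerD2r.
Qed.

Theorem lemma5p11 (R : realType) (d : nat) (d_gt0 : (0 < d)%N) :
  (forall K : R -> R, is_gauge (fun t => (K t)^-1) ->
     forall E : set 'rV[R]_d, borel E -> bounded_set E ->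
       (2^-1%:E * capacity K E <= hcontent (fun t => (K t)^-1)%R E)%E)
  /\
  (forall (h K : R -> R) (gh : is_gauge h) (gK : is_gauge (fun t => (K t)^-1))
     (dhat : R),
     locally_absolutely_continuous h ->
     locally_absolutely_continuous K ->
     0 < dhat ->
     (\int[gauge_measure gh]_(t in `]0%R, dhat]) (K t)%:E < +oo)%E ->
     exists2 A : R, 0 < A &
       forall E : set 'rV[R]_d, compact E -> diam E <= dhat ->
         (A%:E * hcontent h E <= capacity K E)%E).
Proof.
split=> [K gK E _ _|h K gh gK dhat _ _]; last exact: hcontent_le_capacity.
have hE0 : (0 <= hcontent (fun t => (K t)^-1)%R E)%E by exact: hcontent_ge0.
apply: (@le_trans _ _ (2^-1%:E * hcontent (fun t => (K t)^-1)%R E)%E).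
  by apply: lee_wpmul2l; [rewrite lee_fin|exact: capacity_le_hcontent].
by apply: gee_pMl => //; rewrite lee_fin; lra.
Qed.
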